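(* Let $N\in\mathbb{N}$ with $N>2$, let $m\in\mathbb{N}$ with $m<N-1$, let $I_N=[0,N)$, and let $\beta\in\left(0,\frac{1}{N-1}\right)$ be a solution of the equation $$\frac{\sin(\pi(N-1)\beta)}{\sin(\pi\beta)}=(N-1)\sin\frac{1}{N-1}.$$ If $\frac{1}{2(N-1)^2}<\delta<\frac{1}{N-1}-\beta$, then $$\mathcal{B}_\delta=\bigcup_{j=0}^{N-2}\left\{e^{2\pi i\left(n+\frac{j}{N-1}-j\delta\right)x}\right\}_{n\in\mathbb{Z}}$$ is a (Riesz) basis for $L^2(I_N\setminus(m,m+1))$ with Riesz constants $A,B$ satisfying $$\left(1-(N-1)\sin\frac{1}{N-1}\right)\left(N-1-\frac{1}{\sin\frac{\pi}{2(N-1)}}\right)\le A$$ and $$B\le\left(1+(N-1)\sin\frac{1}{N-1}\right)\left(N-1+\frac{1}{\sin\frac{\pi}{2(N-1)}}\right).$$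
   Context: $\mathbb{N}=\{1,2,3,\dots\}$. A sequence $\{v_j\}$ in a separable Hilbert space $H$ is a Riesz basis with Riesz (frame) constants $A,B>0$ if for every finite family of complex scalars $\{c_j\}_{j\in J}$ one has $A\sum_{j\in J}|c_j|^2\le\|\sum_{j\in J}c_jv_j\|^2\le B\sum_{j\in J}|c_j|^2$, and for every $w\in H$ one has $A\|w\|^2\le\sum_j|\langle w,v_j\rangle|^2\le B\|w\|^2$. For a measurable $D\subset\mathbb{R}$, $\|f\|_{L^2(D)}^2=\int_D|f(x)|^2dx$, and exponentials are regarded as elements of $L^2(D)$ by restriction to $D$. ''Basis'' for a system of exponentials means Riesz basis. *)

(* Defs.v *)
From HB Require Import structures.
From mathcomp Require Import all_boot all_order all_algebra.
From mathcomp Require Import finmap.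
From mathcomp Require Import complex.
From mathcomp Require Import all_classical all_reals all_analysis.

Set Implicit Arguments.
Unset Strict Implicit.
Unset Printing Implicit Defensive.

Import Order.TTheory GRing.Theory Num.Theory.

Local Open Scope classical_set_scope.
Local Open Scope ring_scope.

Section ComplexL2.
Context {R : realType}.
Implicit Types (D : set R) (f g : R -> R[i]).

Definition cabs2 (z : R[i]) : R := complex.Re z ^+ 2 + complex.Im z ^+ 2.

Definition L2norm2 D f : \bar R :=
  (\int[lebesgue_measure]_(x in D) (cabs2 (f x))%:E)%E.

(* L^2(D) is handled through representatives: functions R -> R[i], of which
   only the restriction to D matters, with the seminorm L2norm2 D. *)
Definition L2 D : set (R -> R[i]) := [set f |
  [/\ measurable_fun D (fun x => complex.Re (f x)),
      measurable_fun D (fun x => complex.Im (f x)) &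
      (L2norm2 D f < +oo)%E]].

(* <f, g> = \int_D f (conj g), computed on real and imaginary parts. *)
Definition L2dot D f g : R[i] :=
  let h x := f x * (g x)^*%C in
  Complex (\int[lebesgue_measure]_(x in D) complex.Re (h x))%R
          (\int[lebesgue_measure]_(x in D) complex.Im (h x))%R.

Definition riesz_basis D (I : choiceType) (v : I -> R -> R[i]) (A B : R) : Prop :=
  [/\ 0 < A, 0 < B,
      forall j, L2 D (v j),
      forall (J : {fset I}) (c : I -> R[i]),
        let S := L2norm2 D (fun x => \sum_(j <- J) c j * v j x) in
        let s := \sum_(j <- J) cabs2 (c j) in
        ((A * s)%:E <= S)%E /\ (S <= (B * s)%:E)%E &
      forall w, L2 D w ->
        let S := (\esum_(j in [set: I]) (cabs2 (L2dot D w (v j)))%:E)%E in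
        (A%:E * L2norm2 D w <= S)%E /\ (S <= B%:E * L2norm2 D w)%E].

(* x |-> e^{2 pi i lam x} *)
Definition cexp2pi (lam x : R) : R[i] :=
  Complex (cos (2 * pi * lam * x)) (sin (2 * pi * lam * x)).

(* Indexed by pairs (j, n) with 0 <= j <= N - 2. *)
Definition exp_system (N : nat) (delta : R) (k : 'I_N.-1 * int) : R -> R[i] :=
  cexp2pi (k.2%:~R + k.1%:R / (N%:R - 1) - k.1%:R * delta).

End ComplexL2.

(* Main.v *)
(* Put L = N - 1 and a = 1/L - delta, so that the frequencies are n + j a with
   0 <= j < L.  Cutting the domain into the unit cells [p, p + 1), p <> m, and
   expanding in Fourier series on [0, 1) (Parseval), both Riesz inequalities
   become bounds for the squared singular values of the L x L matrix M with
   entries exp(2 pi i a p j), 0 <= p <= L, p <> m.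

   The equation for beta forces beta >= 1/(L + 1), hence
   1/(L + 1) <= a <= 1/L - 1/(2 L^2).

   Lower bound.  The inverse of M is given by Lagrange interpolation at the nodes
   exp(2 pi i a p): its entries are the coefficients of (Q_p - Q_m) / Q_p(x_p),
   where Q_p is the product of the X - x_q, q <> p.  After a rotation the
   polynomial V with all L + 1 nodes as roots has real coefficients (Gaussian
   binomials) of known signs, and its value at -1 shows that their absolute values
   sum to at most 4; so the coefficients of the Q_p have modulus at most 2.
   Moreover |Q_p(x_p)|^2 is at least the squared product of the 2 sin(pi i a),
   1 <= i <= L, which is at least pi L / 2 by comparison with the cases a = 1/L and
   a = 1/(L + 1).  The Frobenius norm of the inverse is therefore at most
   32 L / pi, and the claimed lower constant is at most pi / (32 L).

   Upper bound.  By Bessel's inequality, applied to step functions that are constant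
   on the intervals [j a, (j + 1) a), the norm of M squared is at most
   pi^2 / (4 a); for L <= 3 the Frobenius norm of M suffices. *)

Require Import Defs.
From HB Require Import structures.
From mathcomp Require Import all_boot all_order all_algebra.
From mathcomp Require Import finmap.
From mathcomp Require Import all_classical all_reals all_analysis.
From mathcomp Require Import measurable_realfun complex ring lra zify.

Set Implicit Arguments.
Unset Strict Implicit.
Unset Printing Implicit Defensive.

Import Order.TTheory GRing.Theory Num.Theory.
Import numFieldNormedType.Exports.

Local Open Scope classical_set_scope.
Local Open Scope ring_scope.

(** * Unimodular numbers *)

Section Cis.
Context {R : realType}.
Implicit Types x y t : R.
Local Open Scope complex_scope.

(** The obstacle is the missing cell: without row [m] the nodes are unequally spaced, and estimates
    for their own Lagrange basis would depend on [m]. Hence the detour through all [L + 1] nodes: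
    [Q_p] and [Q_m] are monic of degree [L], so [Q_p - Q_m] has degree below [L], vanishes at every
    kept node except [x_p], and takes the value [Q_p(x_p)] there. One bound on the [Q_p] then serves
    every [m]. The reference values of [a] are those with roots of unity: at [1/(L + 1)] all nodes,
    at [1/L] the first [L], are rotated roots of unity, and the sine products are explicit. The
    condition [a >= 1/(L + 1)] also makes [sin(pi (L + 1) a)] nonpositive, which produces the signs
    in [V]; the condition on [delta] keeps [a] below the midpoint of the two values, where the
    product estimate holds. Crude constants are affordable: [1 - L sin(1/L)] is of order [1/L^2], so
    the claimed lower constant is only of order [1/L], which an entrywise bound on the inverse
    already gives. *)

Definition cis t : R[i] := Complex (cos t) (sin t).

Lemma cis0 : cis 0 = 1.
Proof. by rewrite /cis cos0 sin0. Qed.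

Lemma cisD x y : cis (x + y) = cis x * cis y.
Proof.
rewrite /cis cosD sinD; apply/eqP; rewrite eq_complex /=; apply/andP; split; apply/eqP; ring.
Qed.

Lemma cisN x : cis (- x) = (cis x)^*%C.
Proof. by rewrite /cis cosN sinN. Qed.

Lemma norm_cis x : `|cis x| = 1.
Proof. by rewrite normc_def /= cos2Dsin2 sqrtr1. Qed.

Lemma cis_neq0 x : cis x != 0.
Proof. by rewrite -normr_eq0 norm_cis oner_eq0. Qed.

Lemma cisMn x n : cis (x * n%:R) = cis x ^+ n.
Proof.
elim: n => [|n IH]; first by rewrite mulr0 cis0.
by rewrite exprS -IH -cisD -[n.+1]addn1 natrD mulrDr mulr1 addrC.
Qed.

Lemma prod_cis (I : Type) (r : seq I) (P : pred I) (f : I -> R) :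
  \prod_(i <- r | P i) cis (f i) = cis (\sum_(i <- r | P i) f i).
Proof. by elim/big_rec2: _ => [|i y1 y2 _ ->]; rewrite ?cis0 ?cisD. Qed.

Lemma cisB_sin x y :
  cis (x + y) - cis (x - y) = cis x * (Complex 0 (2 * sin y)).
Proof.
rewrite !cisD cisN; apply/eqP; rewrite eq_complex /=; apply/andP; split; apply/eqP; ring.
Qed.

Lemma cisD_cos x y :
  cis (x + y) + cis (x - y) = cis x * (2 * cos y)%:C.
Proof.
rewrite !cisD cisN; apply/eqP; rewrite eq_complex /=; apply/andP; split; apply/eqP; ring.
Qed.

Lemma cabs2E (z : R[i]) : (cabs2 z)%:C = `|z| ^+ 2.
Proof. by rewrite /cabs2 add_Re2_Im2. Qed.

Lemma cabs2M (z w : R[i]) : cabs2 (z * w) = cabs2 z * cabs2 w.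
Proof. by apply: complexI; rewrite cabs2E normrM exprMn -!cabs2E -rmorphM. Qed.

Lemma cabs2V (z : R[i]) : cabs2 z^-1 = (cabs2 z)^-1.
Proof. by apply: complexI; rewrite fmorphV /= !cabs2E normfV exprVn. Qed.

Lemma cabs2_ge0 (z : R[i]) : 0 <= cabs2 z.
Proof. by rewrite addr_ge0 ?sqr_ge0. Qed.

Lemma cabs2_cis x : cabs2 (cis x) = 1.
Proof. exact: cos2Dsin2. Qed.

Lemma cabs2_conj (z : R[i]) : cabs2 (z^*%C) = cabs2 z.
Proof. by case: z => a b; rewrite /cabs2 /= sqrrN. Qed.

Lemma cabs2_real x : cabs2 (x%:C) = x ^+ 2.
Proof. by rewrite /cabs2 /= expr0n addr0. Qed.

Lemma cabs2_normc (z : R[i]) : cabs2 z = complex.Re (z * z^*%C).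
Proof. by case: z => a b; rewrite /cabs2 /=; ring. Qed.

End Cis.

(** * The node polynomial *)

Section NodePoly.
Context {R : realType}.
Local Open Scope complex_scope.
Variables (tau : R) (L : nat).

(** With [tau = pi * a] these are the points [cis (2 * pi * a * q)] turned by [cis (- tau * L)], so
    that the nodes [q] and [L - q] are conjugate and [node_poly] is real. *)
Definition node (q : nat) : R[i] := cis (tau * (2 * q%:R - L%:R)).

Definition node_poly : {poly R[i]} := \prod_(q < L.+1) ('X - (node q)%:P).

Lemma coef_comp_scale (p : {poly R[i]}) (u : R[i]) k :
  (p \Po (u *: 'X))`_k = u ^+ k * p`_k.
Proof.
rewrite comp_polyE coef_sum.
have [kp|kp] := ltnP k (size p).
  rewrite (bigD1 (Ordinal kp)) //= big1 ?addr0; last first.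
    move=> i ik; rewrite exprZn !coefZ coefXn.
    by move: ik; rewrite -val_eqE /= eq_sym => /negbTE ->; rewrite !mulr0.
  by rewrite exprZn !coefZ coefXn eqxx mulr1 mulrC.
rewrite (nth_default _ kp) mulr0 big1 // => i _.
rewrite exprZn !coefZ coefXn (_ : k == i = false) ?mulr0 //.
by apply/negbTE; rewrite neq_ltn (leq_trans (ltn_ord i) kp) orbT.
Qed.

Lemma nodeS q : node q.+1 = cis (2 * tau) * node q.
Proof. by rewrite /node -cisD; congr cis; ring. Qed.

(* Multiplying the argument by [cis (2 * tau)] shifts the nodes by one. *)
Lemma node_poly_shift :
  ('X - (cis (tau * L%:R))%:P) * (node_poly \Po (cis (2 * tau) *: 'X))
  = cis (2 * tau) ^+ L.+1 *: (('X - (cis (- (tau * (L%:R + 2))))%:P) * node_poly).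
Proof.
set u := cis (2 * tau).
have uE c : u * c - u * c = 0 :> R[i] by rewrite subrr.
have -> : node_poly \Po (u *: 'X)
  = \prod_(q < L.+1) (u *: ('X - (u^-1 * node q)%:P)).
  rewrite /node_poly rmorph_prod /=; apply: eq_bigr => q _.
  rewrite comp_polyB comp_polyX comp_polyC scalerBr; congr (_ - _).
  by rewrite -mul_polyC -polyCM mulrA divff ?cis_neq0 // mul1r.
rewrite scaler_prod prodr_const card_ord -scalerAr; congr (_ *: _).
rewrite big_ord_recl /= mulrCA; congr (_ * _).
  congr ('X - (_)%:P); rewrite /node.
  apply: (mulfI (cis_neq0 (2 * tau))); rewrite mulrA divff ?cis_neq0 // mul1r -cisD.
  by congr cis; ring.
rewrite [RHS]big_ord_recr mulrC /=; congr (_ * _).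
  apply: eq_bigr => q _; congr ('X - (_)%:P).
  by rewrite /bump /= add1n nodeS mulrA mulVf ?cis_neq0 // mul1r.
by rewrite /node; congr ('X - (cis _)%:P); ring.
Qed.

(** Coefficient [k + 1] of [node_poly_shift]. This is the two-term recurrence of Gaussian binomials
    in sine form, written without division because a sine may vanish. *)
Lemma node_poly_coefS k :
  node_poly`_k.+1 * (sin (tau * k.+1%:R))%:C
  = - (node_poly`_k * (sin (tau * (L.+1%:R - k%:R)))%:C).
Proof.
have := congr1 (fun p : {poly R[i]} => p`_k.+1) node_poly_shift.
rewrite coefZ !mulrBl !coefB !coefXM !coefCM /= !coef_comp_scale -!cisMn.
set V0 := _`_k; set V1 := _`_k.+1.
(* Exponents are split into a common part plus or minus a half difference, so that [cisB_sin] leaves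
   a common unimodular factor, which cancels, and one sine on each side. *)
have -> : cis (2 * tau * k%:R) = cis (tau * (k%:R + L.+1%:R) + tau * (k%:R - L.+1%:R)).
  by congr cis; ring.
rewrite (_ : cis (2 * tau * L.+1%:R) * (V0 - cis (- (tau * (L%:R + 2))) * V1) =
  cis (tau * (k%:R + L.+1%:R) - tau * (k%:R - L.+1%:R)) * V0
   - cis (tau * (L.+1%:R + k%:R) - tau * (k.+1%:R)) * V1); last first.
  rewrite mulrBr mulrA -cisD; congr (cis _ * _ - cis _ * _); ring.
rewrite mulrA -cisD (_ : tau * L%:R + 2 * tau * k.+1%:R
   = tau * (L.+1%:R + k%:R) + tau * k.+1%:R); last by ring.
move=> /eqP; rewrite -subr_eq0 => /eqP H.
have {H} : (cis (tau * (k%:R + L.+1%:R) + tau * (k%:R - L.+1%:R))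
     - cis (tau * (k%:R + L.+1%:R) - tau * (k%:R - L.+1%:R))) * V0
  = (cis (tau * (L.+1%:R + k%:R) + tau * k.+1%:R)
     - cis (tau * (L.+1%:R + k%:R) - tau * k.+1%:R)) * V1.
  by apply/eqP; rewrite -subr_eq0 -H; apply/eqP; ring.
rewrite !cisB_sin (addrC L.+1%:R) -!mulrA => /(mulfI (cis_neq0 _)).
have i2 (s : R) : Complex 0 (2 * s) = Complex 0 2 * s%:C.
  by apply/eqP; rewrite eq_complex /=; apply/andP; split; apply/eqP; ring.
have i20 : (Complex 0 2 : R[i]) != 0.
  by rewrite eq_complex /= negb_and pnatr_eq0 orbT.
rewrite !i2 -!mulrA => /(mulfI i20).
rewrite -opprB mulrN sinN rmorphN /= mulNr => H.
by rewrite mulrC -H mulrC.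
Qed.

Lemma sum_node_arg : \sum_(q < L.+1) (2 * q%:R - L%:R : R) = 0.
Proof.
rewrite sumrB -mulr_sumr sumr_const card_ord.
have H n : 2 * (\sum_(q < n.+1) (q%:R : R)) = n%:R * (n%:R + 1).
  elim: n => [|n IH]; first by rewrite big_ord_recr big_ord0 /= addr0 mulr0 mul0r.
  by rewrite big_ord_recr /= mulrDr IH -natr1; ring.
by rewrite H -[_ *+ L.+1]mulr_natr -natr1 subrr.
Qed.

Lemma node_poly_coef0 : node_poly`_0 = (-1) ^+ L.+1.
Proof.
rewrite -horner_coef0 horner_prod.
under eq_bigr do rewrite hornerXsubC sub0r -mulN1r.
rewrite big_split /= prodr_const card_ord prod_cis.
rewrite (_ : \sum_(q < L.+1) _ = 0) ?cis0 ?mulr1 //.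
by rewrite -mulr_sumr sum_node_arg mulr0.
Qed.

Lemma size_node_poly : size node_poly = L.+2.
Proof. by rewrite size_prod_XsubC /index_enum /= -enumT size_enum_ord. Qed.

Lemma node_poly_monic : node_poly \is monic.
Proof. exact: monic_prod_XsubC. Qed.

Lemma node_poly_coef_lead : node_poly`_L.+1 = 1.
Proof. by have /monicP := node_poly_monic; rewrite lead_coefE size_node_poly. Qed.

End NodePoly.

(** * Signs and absolute sum of the coefficients of the node polynomial *)

Section NodePolyNorm.
Context {R : realType}.
Local Open Scope complex_scope.
Variables (tau : R) (L : nat).
Hypotheses (tau0 : 0 < tau) (L0 : (0 < L)%N).
Hypotheses (tauL : tau * L%:R < pi) (tauL1 : pi <= tau * L.+1%:R).

Local Notation V := (node_poly tau L).

(** In the recurrence [sin (tau * L.+1)] is nonpositive, so the first step keeps the sign of the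
    constant term; all later steps involve positive sines only and flip it. The order of [R[i]] also
    records that the coefficient is real. *)
Lemma node_poly_coef_sign k : (k < L)%N -> 0 <= (-1) ^+ (L + k.+1) * V`_k.+1.
Proof.
have sin_pos i : (0 < i <= L)%N -> 0 < sin (tau * i%:R).
  move=> /andP[i0 iL]; apply: sin_gt0_pi; rewrite mulr_gt0 ?ltr0n //=.
  by rewrite (le_lt_trans _ tauL) // ler_pM2l // ler_nat.
elim: k => [_|k IH kL].
  have := node_poly_coefS tau L 0; rewrite node_poly_coef0 => H.
  have s0 : 0 < sin (tau * 1%:R) by apply: sin_pos; rewrite L0.
  have s1 : 0 <= - sin (tau * L.+1%:R).
    rewrite -[tau * _](subrK pi) sinDpi opprK; apply: sin_ge0_pi.
    rewrite subr_ge0 tauL1 lerBlDr -natr1 mulrDr mulr1.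
    rewrite lerD ?(ltW tauL) // (le_trans _ (ltW tauL)) //.
    by rewrite ler_peMr ?ler1n // ltW.
  rewrite -(pmulr_lge0 _ (x := (sin (tau * 1%:R))%:C)); last by rewrite ltcR.
  rewrite -mulrA H subr0 addn1 mulrN mulrA -expr2 sqrr_sign mul1r.
  by rewrite -rmorphN /= lecR.
rewrite -(pmulr_lge0 _ (x := (sin (tau * k.+2%:R))%:C)); last first.
  by rewrite ltcR sin_pos.
rewrite -mulrA node_poly_coefS mulrN mulrA addnS exprS !mulN1r !mulNr opprK.
apply: mulr_ge0; first by apply: IH; exact: ltnW.
rewrite lecR ltW // -natrB; last by rewrite ltnS ltnW // ltnW.
by apply: sin_pos; lia.
Qed.

(* At [-1] all the inner coefficients contribute with the same sign, and the
   value there is, up to sign, the product of the nonnegative numbers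
   [2 cos (tau * (q - L / 2))]. *)
Lemma sum_norm_node_poly : \sum_(k < L.+2) `|V`_k| <= 4.
Proof.
pose S := \sum_(k < L) `|V`_k.+1|.
have inner (k : 'I_L) : (-1) ^+ (L.+1 + k.+1) * V`_k.+1 = - `|V`_k.+1|.
  have := node_poly_coef_sign (ltn_ord k).
  rewrite addSn exprS mulN1r mulNr => H; congr (- _).
  by rewrite -{1}(ger0_norm H) normrM normrX normrN1 expr1n mul1r.
have -> : \sum_(k < L.+2) `|V`_k| = 2 + S.
  rewrite big_ord_recr big_ord_recl /= node_poly_coef_lead node_poly_coef0.
  rewrite normrX normrN1 expr1n normr1 (_ : \sum_(i < L) _ = S); first by ring.
  by apply: eq_bigr => i _; rewrite /bump /= add1n.
have E1 : (-1) ^+ L.+1 * V.[-1] = 2 - S.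
  rewrite (@horner_coef_wide _ L.+2) ?size_node_poly //.
  rewrite big_ord_recr big_ord_recl /= node_poly_coef_lead node_poly_coef0.
  rewrite mul1r expr0 mulr1 mulrDr mulrDr -!expr2 sqrr_sign.
  rewrite (_ : _ * \sum_(i < L) _ = - S); first by ring.
  rewrite mulr_sumr -sumrN; apply: eq_bigr => i _.
  by rewrite -inner /bump /= add1n exprD -mulrA (mulrC V`_i.+1).
have : 0 <= (-1) ^+ L.+1 * V.[-1].
  rewrite /node_poly horner_prod.
  under eq_bigr => q _.
    rewrite hornerXsubC (_ : -1 - _ = -1 * (cis (tau * (2 * q%:R - L%:R) / 2) *
      (2 * cos (tau * (2 * q%:R - L%:R) / 2))%:C)); last first.
      rewrite -cisD_cos subrr cis0 -splitr mulN1r opprD addrC //.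
    over.
  rewrite !big_split /= prodr_const card_ord.
  rewrite signrMK prod_cis.
  rewrite -mulr_suml -mulr_sumr sum_node_arg mulr0 mul0r cis0 mul1r.
  apply: prodr_ge0 => q _; rewrite lecR mulr_ge0 // cos_ge0_pihalf //.
  have hq : q%:R <= L%:R :> R by rewrite ler_nat -ltnS.
  have q0 : 0 <= q%:R :> R by rewrite ler0n.
  have h1 : tau * q%:R <= tau * L%:R by rewrite ler_pM2l.
  have h2 : 0 <= tau * q%:R by rewrite mulr_ge0 // ltW.
  rewrite (_ : tau * (_ - _) / 2 = tau * q%:R - tau * L%:R / 2); last by field.
  have h3 := tauL; move: h1 h2 h3.
  move: (tau * q%:R) (tau * L%:R) (pi : R) => u v w h1 h2 h3.
  apply/andP; split; lra.
by rewrite E1 subr_ge0 => S2; rewrite (_ : 4 = 2 + 2) ?lerD2l //; ring.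
Qed.

End NodePolyNorm.

(** * Sine products *)

Section SineBounds.
Context {R : realType}.
Implicit Types x y : R.
Local Open Scope complex_scope.

Lemma sin_le_id x : 0 <= x -> sin x <= x.
Proof.
move=> x0.
have [c _] : exists2 c, c \in `[0, x]%R & sin x - sin 0 = cos c * (x - 0).
  by apply: MVT_segment => // ; apply: continuous_subspaceT; exact: continuous_sin.
by rewrite sin0 !subr0 => ->; rewrite ler_piMl // cos_le1.
Qed.

Lemma mul_cos_le_sin x : 0 <= x <= pi -> x * cos x <= sin x.
Proof.
move=> /andP[x0 xpi]; rewrite -subr_ge0.
have [||c c0] := @MVT_segment R (fun x => sin x - x * cos x) (fun x => x * sin x) 0 x x0.
- by move=> y _; apply: is_derive_eq; rewrite /GRing.scale /=; ring.
- by apply: derivable_within_continuous => y _; apply: ex_derive.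
rewrite sin0 mul0r !subr0 => ->; rewrite mulr_ge0 // mulr_ge0 //.
  by move: c0; rewrite in_itv /= => /andP[].
apply: sin_ge0_pi; move: c0; rewrite in_itv /= => /andP[-> cx] /=.
exact: le_trans xpi.
Qed.

(** Half-angle argument: with [s], [c] the sine and cosine of [x / 2], [x / 2 * c <= s] gives
    [sin x = 2 s c >= x c^2 = x (1 - s^2)], and [s <= x / 2]. The coefficient 1/4, in place of
    Taylor's 1/6, suffices for the constants below. *)
Lemma sin_ge_cubic x : 0 <= x <= pi -> x - x ^+ 3 / 4 <= sin x.
Proof.
move=> /andP[x0 xpi].
have h0 : 0 <= x / 2 by rewrite divr_ge0.
have c0 : 0 <= cos (x / 2).
  apply: cos_ge0_pihalf; rewrite ler_pM2r ?invr_gt0 // xpi andbT.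
  by rewrite (le_trans _ h0) // oppr_le0 divr_ge0 // pi_ge0.
have hs : x / 2 * cos (x / 2) <= sin (x / 2).
  by apply: mul_cos_le_sin; rewrite h0 /= (le_trans _ xpi) //
    ler_pdivrMr // ler_peMr // ler1n.
have s2 : sin (x / 2) ^+ 2 <= (x / 2) ^+ 2.
  rewrite ler_sqr ?nnegrE // ?sin_le_id // (le_trans _ hs) // mulr_ge0 //.
have -> : sin x = 2 * (sin (x / 2) * cos (x / 2)).
  rewrite -[x in LHS](divfK (x := 2)) // mulr_natr sin_mulr2n -mulr_natl.
  by rewrite mulrC (mulrC (cos _)) mulrC.
have := cos2Dsin2 (x / 2).
move: (sin (x / 2)) (cos (x / 2)) c0 hs s2 => s c c0 hs s2 cs.
have : x / 2 * c * c <= s * c by rewrite ler_wpM2r.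
nra.
Qed.

(** Midpoint log-concavity of the sine; it needs no range because the difference of the two sides is
    a square. *)
Lemma sqr_sin_mid x y : sin x * sin y <= sin ((x + y) / 2) ^+ 2.
Proof.
rewrite -subr_ge0.
suff -> : sin ((x + y) / 2) ^+ 2 - sin x * sin y = sin ((x - y) / 2) ^+ 2.
  exact: sqr_ge0.
have -> : sin x = sin ((x + y) / 2 + (x - y) / 2) by congr sin; field.
have -> : sin y = sin ((x + y) / 2 - (x - y) / 2) by congr sin; field.
rewrite sinD sinB.
have := cos2Dsin2 ((x + y) / 2); have := cos2Dsin2 ((x - y) / 2).
move: (sin ((x + y) / 2)) (cos ((x + y) / 2)) (sin ((x - y) / 2)) (cos ((x - y) / 2)).
move=> s c s' c' /(canRL (addrK _)) H' /(canRL (addrK _)) H.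
rewrite (_ : (s * c' + c * s') * _ = s ^+ 2 * c' ^+ 2 - c ^+ 2 * s' ^+ 2); last by ring.
rewrite H H'; ring.
Qed.

Lemma ler_cos x y : 0 <= x -> x <= y -> y <= pi -> cos y <= cos x.
Proof.
move=> x0; rewrite le_eqVlt => /predU1P[->//|xy] ypi.
rewrite ltW // ltr_cos // in_itv /= ?x0 ?ypi ?andbT //.
- by rewrite (le_trans (ltW xy)).
- by rewrite (le_trans x0) // ltW.
Qed.

(** Here [y] is at least as far from [pi / 2] as [x]; the difference is
    [- 2 cos ((x + y) / 2) sin ((y - x) / 2)] with a nonpositive cosine. *)
Lemma ler_sin_refl x y : 0 <= x -> x <= y -> y <= pi -> pi <= x + y ->
  sin y <= sin x.
Proof.
move=> x0 xy ypi xypi; rewrite -subr_ge0.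
have -> : sin x = sin ((x + y) / 2 - (y - x) / 2) by congr sin; field.
have -> : sin y = sin ((x + y) / 2 + (y - x) / 2) by congr sin; field.
rewrite sinB sinD.
have p0 := pi_ge0 R.
have s0 : 0 <= sin ((y - x) / 2) by apply: sin_ge0_pi; apply/andP; split; lra.
have c0 : 0 <= - cos ((x + y) / 2).
  rewrite -cosDpi -cosN -cosD2pi; apply: cos_ge0_pihalf.
  by rewrite -mulr_natl; apply/andP; split; lra.
move: c0 s0; move: (sin ((y - x) / 2)) (cos ((x + y) / 2)) => s c c0 s0.
have := mulr_ge0 c0 s0; move: (sin _) (cos _) => s' c'; nra.
Qed.

(** Modulus at 1 of [(X^n - 1) / (X - 1)], written once as [1 + X + ... + X^(n-1)] and once as the
    product of the [X - z^i], [0 < i < n], for a primitive root [z]. *)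
Lemma prod_sin_root n : (0 < n)%N ->
  \prod_(i < n.-1) (2 * sin (pi / n%:R * i.+1%:R)) = n%:R :> R.
Proof.
move=> n0.
have nR : n%:R != 0 :> R by rewrite pnatr_eq0 -lt0n.
have nR0 : 0 < n%:R :> R by rewrite ltr0n.
have sp k : (0 < k < n)%N -> 0 < sin (pi / n%:R * k%:R : R).
  move=> /andP[k0 kn]; apply: sin_gt0_pi.
  rewrite mulr_gt0 ?divr_gt0 ?pi_gt0 ?ltr0n //=.
  by rewrite mulrAC ltr_pdivrMr // ltr_pM2l ?pi_gt0 // ltr_nat.
pose z := cis (2 * (pi / n%:R) : R).
have zk k : z ^+ k - 1 = cis (pi / n%:R * k%:R) * Complex 0 (2 * sin (pi / n%:R * k%:R)).
  by rewrite -cisB_sin subrr cis0 /z -cisMn; congr (cis _ - 1); ring.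
have zn : z ^+ n = 1.
  by apply/eqP; rewrite -subr_eq0 zk mulfVK // sinpi mulr0 mulr0.
have zkn k : (0 < k < n)%N -> z ^+ k != 1.
  move=> kn; rewrite -subr_eq0 zk mulf_neq0 ?cis_neq0 // eq_complex /= negb_and.
  by rewrite mulf_neq0 ?orbT // gt_eqF // sp.
have prim : n.-primitive_root z.
  rewrite /primitive_root_of_unity n0 /=; apply/forallP => i.
  rewrite unity_rootE; case: (ltngtP i.+1 n) => [lt|lt|->].
  - by rewrite (negbTE (zkn _ _)) ?lt.
  - by have := ltn_ord i; rewrite leqNgt lt.
  - by rewrite zn eqxx.
have := factor_Xn_sub_1 prim; rewrite big_ltn // expr0.
have -> : 'X^n - 1 = ('X - 1%:P) * (\sum_(i < n) 'X^i) :> {poly R[i]}.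
  by rewrite polyC1 subrX1.
have X1 : ('X - 1%:P : {poly R[i]}) != 0 by rewrite polyXsubC_eq0.
move=> /(mulfI X1) /(congr1 (fun p => p.[1])).
rewrite horner_prod horner_sum.
under [RHS]eq_bigr do rewrite hornerXn expr1n.
rewrite sumr_const card_ord => /(congr1 Num.norm).
rewrite normr_prod normr_nat big_add1 big_mkord => H.
apply: complexI; rewrite rmorph_prod /= rmorph_nat -H.
apply: eq_bigr => i _; rewrite hornerXsubC -normrN opprB zk normrM norm_cis mul1r.
rewrite normc_def /= expr0n add0r sqrtr_sqr ger0_norm //.
by rewrite mulr_ge0 // ltW // sp //; have := ltn_ord i; lia.
Qed.
End SineBounds.

(** * Lower bound for the product of the sines *)

Section SineProduct.
Context {R : realType}.
Implicit Types tau : R.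

Definition sin_prod tau (k : nat) : R := \prod_(i < k) (2 * sin (tau * i.+1%:R)).

Variables (tau : R) (L : nat).
Hypotheses (tau0 : 0 < tau) (L0 : (0 < L)%N).
Hypotheses (tauL : tau * L%:R < pi) (tauL1 : pi <= tau * L.+1%:R).

Lemma sin_tau_gt0 k : (k < L)%N -> 0 < sin (tau * k.+1%:R).
Proof.
move=> kL; apply: sin_gt0_pi; rewrite mulr_gt0 ?ltr0n //=.
by rewrite (le_lt_trans _ tauL) // ler_pM2l // ler_nat.
Qed.

(** A Gaussian binomial of modulus at least 1 would reverse this. For [2 p <= L] the factors at
    [L - i] and [i + 1] are compared, [i < p]: their arguments add up to [tau * L.+1 >= pi], so
    [ler_sin_refl] applies. *)
Lemma sin_prod_split p : (p <= L)%N ->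
  sin_prod tau L <= sin_prod tau p * sin_prod tau (L - p).
Proof.
wlog pL2 : p / (p.*2 <= L)%N.
  move=> H pL; case: (leqP p.*2 L) => [/H|H2]; first exact.
  have -> : sin_prod tau p = sin_prod tau (L - (L - p)) by rewrite subKn.
  by rewrite mulrC; apply: H; [lia | exact: leq_subr].
move=> pL; have -> : sin_prod tau L = sin_prod tau (L - p + p) by rewrite subnK.
rewrite {1}/sin_prod big_split_ord /= mulrC.
have pos k : (k <= L)%N -> 0 <= sin_prod tau k.
  move=> kL; apply: prodr_ge0 => i _.
  by rewrite mulr_ge0 // ltW // sin_tau_gt0 // (leq_trans _ kL).
apply: ler_wpM2r; first by apply: pos; lia.
rewrite (reindex_inj rev_ord_inj) /=; apply: ler_prod => i _; apply/andP; split.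
  by rewrite mulr_ge0 // ltW // sin_tau_gt0 //; have := ltn_ord i; lia.
have ip := ltn_ord i.
rewrite ler_pM2l // (_ : (L - p + (p - i.+1)).+1 = (L - i)%N); last by lia.
apply: ler_sin_refl.
- by rewrite mulr_ge0 // ltW.
- by rewrite ler_pM2l // ler_nat; lia.
- by rewrite (le_trans _ (ltW tauL)) // ler_pM2l // ler_nat; lia.
- by rewrite -mulrDr -natrD (_ : (i.+1 + (L - i) = L.+1)%N); last by lia.
Qed.

(** Midpoint of the two arguments at which [prod_sin_root] evaluates the product. *)
Let t0 : R := (pi / L%:R + pi / L.+1%:R) / 2.

(** Reversing the index pairs the factors [i + 1] and [L - i], whose arguments add up to [t * L.+1]
    for every [i]; product-to-sum then yields terms that are monotone in [t]. *)
Lemma mul_sin_rev (t : R) (i : nat) : (i < L)%N ->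
  2 * sin (t * i.+1%:R) * (2 * sin (t * (L - i.+1).+1%:R))
  = 2 * (cos (t * `|2 * i%:R + 1 - L%:R|) - cos (t * L.+1%:R)).
Proof.
move=> iL; rewrite -subSn // subSS natrB; last exact: ltnW.
have -> : cos (t * `|2 * i%:R + 1 - L%:R|) = cos (t * i.+1%:R - t * (L%:R - i%:R)).
  have [h|h] := leP 0 (2 * i%:R + 1 - L%:R : R).
    by rewrite ger0_norm //; congr cos; rewrite -natr1; ring.
  by rewrite ltr0_norm // -cosN; congr cos; rewrite -natr1; ring.
have -> : cos (t * L.+1%:R) = cos (t * i.+1%:R + t * (L%:R - i%:R)).
  by congr cos; rewrite -!natr1; ring.
rewrite cosB cosD; ring.
Qed.

Lemma sin_prod_sqr (t : R) : sin_prod t L ^+ 2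
  = \prod_(i < L) (2 * (cos (t * `|2 * i%:R + 1 - L%:R|) - cos (t * L.+1%:R))).
Proof.
rewrite expr2 {2}/sin_prod (reindex_inj rev_ord_inj) /= -big_split /=.
by apply: eq_bigr => i _; exact: mul_sin_rev.
Qed.

(** In each paired factor [cos (t * d) - cos (t * L.+1)] the first cosine decreases in [t], and the
    second increases because its argument stays in [[pi, 2 pi]]. So the product is smallest at the
    right end [t0]. *)
Lemma sin_prod_mono : tau <= t0 -> sin_prod t0 L ^+ 2 <= sin_prod tau L ^+ 2.
Proof.
move=> tt0.
have Lp : 0 < L%:R :> R by rewrite ltr0n.
have t0p : 0 < t0 by apply: lt_le_trans tt0.
have pi0 := pi_gt0 R.
have LL1 : pi / L.+1%:R <= pi / L%:R :> R.
  by rewrite ler_pM2l // lef_pV2 ?posrE ?ltr0n // ler_nat.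
have t0L : t0 * L%:R <= pi.
  rewrite -ler_pdivlMr // /t0; move: LL1; move: (_ / _) (_ / _) => u v; lra.
have t0L1 : t0 * L.+1%:R <= pi *+ 2.
  rewrite -natr1 mulrDr mulr1 mulr2n lerD //.
  by rewrite (le_trans _ t0L) // ler_peMr ?ler1n // ltW.
rewrite !sin_prod_sqr; apply: ler_prod => i _.
apply/andP; split.
  have sin_ge0 k : (k <= L)%N -> 0 <= sin (t0 * k%:R).
    move=> kL; apply: sin_ge0_pi; rewrite mulr_ge0 ?(ltW t0p) //=.
    by rewrite (le_trans _ t0L) // ler_pM2l // ler_nat.
  rewrite -mul_sin_rev // mulr_ge0 // mulr_ge0 // sin_ge0 //.
  by have := ltn_ord i; lia.
have di : `|2 * i%:R + 1 - L%:R| <= L%:R :> R.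
  have iL : i%:R + 1 <= L%:R :> R by rewrite natr1 ler_nat.
  by have := ler0n R i; move: iL; move: (i%:R) (L%:R) => u v; rewrite ler_norml; lra.
have d0 := normr_ge0 (2 * i%:R + 1 - L%:R : R).
move: (`|_|) di d0 => d di d0.
have H : cos (t0 * L.+1%:R) >= cos (tau * L.+1%:R).
  have co x : cos x = - cos (x - pi) :> R by rewrite -cosDpi subrK.
  rewrite (co (tau * _)) (co (t0 * _)) lerN2; apply: ler_cos.
  - by rewrite subr_ge0.
  - by rewrite lerB // ler_pM2r // ltr0n.
  - by rewrite lerBlDr -mulr2n.
have H2 : cos (t0 * d) <= cos (tau * d).
  apply: ler_cos; first by rewrite mulr_ge0 // ltW.
  - by rewrite ler_wpM2r.
  - by rewrite (le_trans _ t0L) // ler_wpM2l // ltW.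
by rewrite ler_pM2l // lerB.
Qed.

(** At [t0], [sqr_sin_mid] bounds the square of the first [L - 1] factors below by the product of
    those at [pi / L], which is [L], and those at [x = pi / (L + 1)], which is
    [(L + 1) / (2 sin x)]. The last factor is [2 sin (x / 2)], and
    [L (L + 1) tan (x / 2) >= pi L / 2] remains. *)
Lemma sin_prod_ge : tau <= t0 -> pi * L%:R / 2 <= sin_prod tau L ^+ 2.
Proof.
move=> /sin_prod_mono; apply: le_trans.
have Lp : 0 < L%:R :> R by rewrite ltr0n.
have L1p : 0 < L.+1%:R :> R by rewrite ltr0n.
have pi0 := pi_gt0 R.
pose x := pi / L.+1%:R : R.
pose P2 := \prod_(i < L.-1) (2 * sin (x * i.+1%:R)).
have LE : L = L.-1.+1 by rewrite prednK.
have x0 : 0 < x by rewrite divr_gt0.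
have xpi : x <= pi by rewrite /x ler_pdivrMr // ler_peMr ?ler1n // ltW.
have P2E : P2 * (2 * sin x) = L.+1%:R.
  rewrite -[RHS]prod_sin_root //= -/x [in RHS]LE big_ord_recr /= -/P2 -LE.
  congr (_ * (2 * _)); have -> : x * L%:R = pi - x.
    by rewrite /x -natr1; field; rewrite natr1 gt_eqF.
  by rewrite sinB sinpi cospi; ring.
have root_ge0 n i : (i < n)%N -> 0 <= 2 * sin (pi / n%:R * i.+1%:R) :> R.
  move=> iN; have n0 : 0 < n%:R :> R by rewrite ltr0n; exact: leq_ltn_trans iN.
  rewrite mulr_ge0 //; apply: sin_ge0_pi; apply/andP; split.
    by rewrite mulr_ge0 // divr_ge0 // ltW.
  by rewrite mulrAC ler_pdivrMr // ler_pM2l // ler_nat.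
have P2ge : L%:R * P2 <= (\prod_(i < L.-1) (2 * sin (t0 * i.+1%:R))) ^+ 2.
  rewrite -(prod_sin_root L0) -prodrXl -big_split /=; apply: ler_prod => i _.
  have iL := ltn_ord i; apply/andP; split.
    by rewrite mulr_ge0 // root_ge0 //; lia.
  rewrite mulrACA exprMn ler_pM2l //.
  have -> : t0 * i.+1%:R = (pi / L%:R * i.+1%:R + x * i.+1%:R) / 2.
    by rewrite /t0 -/x; field; rewrite gt_eqF.
  exact: sqr_sin_mid.
have -> : sin_prod t0 L = (2 * sin (x / 2)) * \prod_(i < L.-1) (2 * sin (t0 * i.+1%:R)).
  rewrite /sin_prod [in LHS]LE big_ord_recr /= -LE mulrC; congr (2 * _ * _).
  have -> : t0 * L%:R = pi - x / 2.
    by rewrite /t0 /x -natr1; field; rewrite natr1 !gt_eqF.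
  by rewrite sinB sinpi cospi; ring.
rewrite exprMn; apply: le_trans (ler_wpM2l _ P2ge); last exact: sqr_ge0.
have h0 : 0 < x / 2 by rewrite divr_gt0.
have hpi : x / 2 < pi / 2.
  by rewrite ltr_pM2r ?invr_gt0 // /x ltr_pdivrMr // ltr_pMr // ltr1n ltnS.
have c0 : 0 < cos (x / 2).
  by apply: cos_gt0_pihalf; rewrite hpi andbT (lt_trans _ h0) // oppr_lt0 divr_gt0.
have hs : x / 2 * cos (x / 2) <= sin (x / 2).
  by apply: mul_cos_le_sin; apply/andP; split; [exact: ltW | lra].
have s2 : sin x = 2 * (sin (x / 2) * cos (x / 2)).
  have {1}-> : x = (x / 2) *+ 2 by rewrite -mulr_natr divfK.
  by rewrite sin_mulr2n -mulr_natl (mulrC (cos _)).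
have xL : x * L.+1%:R = pi by rewrite /x divfK // gt_eqF.
rewrite -(ler_pM2r c0) -xL.
have -> : (2 * sin (x / 2)) ^+ 2 * (L%:R * P2) * cos (x / 2)
   = L%:R * sin (x / 2) * (P2 * (2 * sin x)) by rewrite s2; ring.
rewrite P2E.
have -> : x * L.+1%:R * L%:R / 2 * cos (x / 2)
   = L%:R * (x / 2 * cos (x / 2)) * L.+1%:R by field.
by rewrite ler_pM2r // ler_pM2l.
Qed.

End SineProduct.

(** * Lagrange interpolation at the nodes *)

Section CauchySchwarz.
Context {R : realType}.

Lemma sqr_sum_le (n : nat) (a b : 'I_n -> R) :
  (\sum_i a i * b i) ^+ 2 <= (\sum_i a i ^+ 2) * (\sum_i b i ^+ 2).
Proof.
elim: n a b => [|n IH] a b; first by rewrite !big_ord0 expr0n mulr0.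
rewrite !big_ord_recr /=.
have := IH (fun i => a (widen_ord (leqnSn n) i)) (fun i => b (widen_ord (leqnSn n) i)).
have : 0 <= \sum_(i < n) a (widen_ord (leqnSn n) i) ^+ 2.
  by apply: sumr_ge0 => i _; exact: sqr_ge0.
have : 0 <= \sum_(i < n) b (widen_ord (leqnSn n) i) ^+ 2.
  by apply: sumr_ge0 => i _; exact: sqr_ge0.
set A := \sum_(i < n) a _ ^+ 2; set B := \sum_(i < n) b _ ^+ 2.
set S := \sum_(i < n) _ * _; set x := a ord_max; set y := b ord_max.
move=> B0 A0 SAB.
suff : 2 * S * x * y <= A * y ^+ 2 + B * x ^+ 2.
  move=> h.
  rewrite -subr_ge0 (_ : _ - _ = (A * B - S ^+ 2)
    + (A * y ^+ 2 + B * x ^+ 2 - 2 * S * x * y)); last by ring.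
  by rewrite addr_ge0 // subr_ge0.
have [A00|An0] := eqVneq A 0.
  have S0 : S = 0.
    apply/eqP; rewrite -sqrf_eq0 eq_le sqr_ge0 andbT.
    by rewrite A00 mul0r in SAB.
  by rewrite A00 S0 !(mul0r, mulr0) add0r mulr_ge0 // sqr_ge0.
have A1 : 0 < A by rewrite lt_def An0.
rewrite -(ler_pM2l A1).
rewrite -subr_ge0.
have -> : A * (A * y ^+ 2 + B * x ^+ 2) - A * (2 * S * x * y)
   = (A * y - S * x) ^+ 2 + (A * B - S ^+ 2) * x ^+ 2 by ring.
by rewrite addr_ge0 ?sqr_ge0 // mulr_ge0 ?sqr_ge0 // subr_ge0.
Qed.

Lemma cabs2_sum_le (n : nat) (a b : 'I_n -> R[i]) :
  cabs2 (\sum_i a i * b i) <= (\sum_i cabs2 (a i)) * (\sum_i cabs2 (b i)).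
Proof.
have normcE (z : R[i]) : `|z| = (Num.sqrt (cabs2 z))%:C%C by rewrite normc_def.
rewrite -(@lecR R) cabs2E.
apply: (@le_trans _ _ ((\sum_i `|a i| * `|b i|) ^+ 2)).
  rewrite lerXn2r ?nnegrE //; first by apply: sumr_ge0 => i _; exact: mulr_ge0.
  by rewrite (le_trans (ler_norm_sum _ _ _)) // ler_sum // => i _; rewrite normrM.
under eq_bigr do rewrite !normcE -rmorphM.
rewrite -rmorph_sum /= -rmorphXn /= lecR (le_trans (sqr_sum_le _ _)) //.
by rewrite le_eqVlt; apply/orP; left; apply/eqP; congr (_ * _);
  apply: eq_bigr => i _; rewrite sqr_sqrtr // cabs2_ge0.
Qed.

Lemma frobenius_le (n : nat) (K : 'I_n -> 'I_n -> R[i]) (F : R) (v : 'I_n -> R[i]) :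
  (forall i j, cabs2 (K i j) <= F) ->
  \sum_i cabs2 (\sum_j K i j * v j) <= (n%:R ^+ 2 * F) * \sum_j cabs2 (v j).
Proof.
move=> KF.
have S0 : 0 <= \sum_j cabs2 (v j) by apply: sumr_ge0 => j _; exact: cabs2_ge0.
apply: (@le_trans _ _ (\sum_(i < n) (n%:R * F) * \sum_j cabs2 (v j))).
  apply: ler_sum => i _; rewrite (le_trans (cabs2_sum_le _ _)) //.
  rewrite ler_wpM2r // (le_trans (ler_sum _ (fun j _ => KF i j))) //.
  by rewrite sumr_const card_ord mulr_natl.
by rewrite sumr_const card_ord -[leLHS]mulr_natl expr2 !mulrA.
Qed.

End CauchySchwarz.

(** * The inverse of the sampling matrix *)

Section Interpolation.
Context {R : realType}.
Local Open Scope complex_scope.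
Variables (tau : R) (L : nat).
Hypotheses (tau0 : 0 < tau) (L0 : (0 < L)%N).
Hypotheses (tauL : tau * L%:R < pi) (tauL1 : pi <= tau * L.+1%:R).

Local Notation V := (node_poly tau L).
Local Notation x := (node tau L).

Definition cofactor_poly (p : 'I_L.+1) : {poly R[i]} :=
  \prod_(q < L.+1 | q != p) ('X - (x q)%:P).
Local Notation Q := cofactor_poly.

Lemma cofactor_polyE (p : 'I_L.+1) : V = ('X - (x p)%:P) * Q p.
Proof. by rewrite /node_poly (bigD1 p). Qed.

Lemma norm_node q : `|x q| = 1. Proof. exact: norm_cis. Qed.

Lemma cofactor_poly_monic p : Q p \is monic.
Proof. by apply: monic_prod => q _; exact: monicXsubC. Qed.

Lemma size_cofactor_poly p : size (Q p) = L.+1.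
Proof.
apply/eqP; rewrite -eqSS -(size_node_poly tau L) (cofactor_polyE p).
by rewrite size_monicM ?monicXsubC ?monic_neq0 ?cofactor_poly_monic // size_XsubC.
Qed.

(** Dividing [V] by [X - x p] from the bottom bounds coefficient [k] by the sum of the [|V_j|] with
    [j <= k]; dividing from the top bounds it by the sum with [j > k]. The two sums total at most 4,
    so the smaller is at most 2. *)
Lemma coef_cofactor_poly_le (p : 'I_L.+1) k : (k <= L.+1)%N -> `|(Q p)`_k| <= 2.
Proof.
move=> kL.
have V0 : V`_0 = - (x p * (Q p)`_0).
  by rewrite (cofactor_polyE p) mulrBl coefB coefXM coefCM /= sub0r.
have VS i : V`_i.+1 = (Q p)`_i - x p * (Q p)`_i.+1.
  by rewrite (cofactor_polyE p) mulrBl coefB coefXM coefCM.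
have bottom i : `|(Q p)`_i| <= \sum_(0 <= j < i.+1) `|V`_j|.
  elim: i => [|i IH]; first by rewrite big_nat1 V0 normrN normrM norm_node mul1r.
  rewrite big_nat_recr //= -[leLHS]mul1r -(norm_node p) -normrM.
  have -> : x p * (Q p)`_i.+1 = (Q p)`_i - V`_i.+1 by rewrite VS opprB addrC subrK.
  by rewrite (le_trans (ler_normB _ _)) // lerD2r.
have top d : (d <= L.+1)%N ->
    `|(Q p)`_(L.+1 - d)| <= \sum_((L.+1 - d).+1 <= j < L.+2) `|V`_j|.
  elim: d => [_|d IH dL].
    by rewrite subn0 big_geq // nth_default ?normr0 // size_cofactor_poly.
  have e : (L.+1 - d = (L.+1 - d.+1).+1)%N by lia.
  rewrite big_ltn; last by lia.
  rewrite -e (_ : (Q p)`_(L.+1 - d.+1) = V`_(L.+1 - d) + x p * (Q p)`_(L.+1 - d)).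
    by rewrite (le_trans (ler_normD _ _)) // lerD2l normrM norm_node mul1r IH // ltnW.
  by rewrite e VS subrK.
have := lerD (bottom k) (top (L.+1 - k)%N (leq_subr _ _)).
rewrite subKn // -(@big_cat_nat _ _ _ k.+1 0%N L.+2) //.
rewrite big_mkord => /le_trans /(_ (sum_norm_node_poly tau0 L0 tauL tauL1)).
rewrite -mulr2n -[leLHS]mulr_natl (_ : 4 = 2 * 2); last by rewrite -natrM.
by rewrite ler_pM2l.
Qed.

(** Each distance [|x p - x q|] is [2 |sin (tau (p - q))|]; the indices below [p] give the first
    product, those above it the second. *)
Lemma norm_cofactor_poly (p : 'I_L.+1) :
  `|(Q p).[x p]| = (sin_prod tau p * sin_prod tau (L - p))%:C.
Proof.
have sin_ge0 k : (k < L)%N -> 0 <= sin (tau * k.+1%:R).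
  by move=> kL; rewrite ltW // (sin_tau_gt0 tau0 tauL).
pose g (q : nat) : R[i] := `|2 * sin (tau * (p%:R - q%:R))|%:C.
have -> : `|(Q p).[x p]| = \prod_(q < L.+1 | q != p) g q.
  rewrite horner_prod normr_prod; apply: eq_bigr => q _.
  rewrite hornerXsubC /node.
  have -> : tau * (2 * p%:R - L%:R) = tau * (p%:R + q%:R - L%:R)
    + tau * (p%:R - q%:R) by ring.
  have -> : tau * (2 * q%:R - L%:R) = tau * (p%:R + q%:R - L%:R)
    - tau * (p%:R - q%:R) by ring.
  rewrite cisB_sin normrM norm_cis mul1r normc_def /= expr0n add0r sqrtr_sqr.
  by [].
have pL : (p < L.+1)%N := ltn_ord p.
have -> : \prod_(q < L.+1 | q != p) g q = \prod_(0 <= q < L.+1 | q != p) g q.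
  by rewrite big_mkord; apply: eq_bigl => q; rewrite -val_eqE.
rewrite (@big_cat_nat _ _ _ p) //=; last exact: ltnW.
rewrite [X in _ * X]big_ltn_cond // eqxx /= rmorphM; congr (_ * _).
  rewrite big_nat_cond (eq_bigl (fun q => (0 <= q < p)%N)); last first.
    by move=> q; case: (ltngtP q p); rewrite ?andbF ?andbT.
  rewrite -big_nat big_nat_rev big_mkord rmorph_prod; apply: eq_bigr => i _.
  have ip := ltn_ord i.
  rewrite /g add0n natrB // opprB addrC subrK ger0_norm // mulr_ge0 // sin_ge0 //.
  by lia.
rewrite big_nat_cond (eq_bigl (fun q => (p.+1 <= q < L.+1)%N)); last first.
  by move=> q; case: (ltngtP q p); rewrite ?andbF ?andbT.
rewrite -big_nat -[p.+1]add0n big_addn subSS big_mkord rmorph_prod.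
apply: eq_bigr => i _; have iL := ltn_ord i.
have -> : g (i + p.+1)%N = `|2 * sin (tau * i.+1%:R)|%:C.
  rewrite /g -normrN -mulrN -sinN; congr (`|2 * sin _|%:C).
  by rewrite natrD -!natr1; ring.
by rewrite ger0_norm // mulr_ge0 // sin_ge0 //; lia.
Qed.

Hypothesis taut0 : tau <= (pi / L%:R + pi / L.+1%:R) / 2.

Variable m : 'I_L.+1.

Definition rows_mx : 'M[R[i]]_L :=
  \matrix_(p, j) cis (2 * tau * (lift m p)%:R * j%:R).

(* The columns are the coefficients of the Lagrange basis [(Q p - Q m) / (Q p).[x p]]
   of the nodes [x p], [p != m], up to unimodular factors. *)
Definition lagrange_mx : 'M[R[i]]_L := \matrix_(j, p)
  (cis (- (tau * L%:R * j%:R)) *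
   ((Q (lift m p) - Q m)`_j / (Q (lift m p)).[x (lift m p)])).

Let L_neq0 : L%:R != 0 :> R. Proof. by rewrite pnatr_eq0 -lt0n. Qed.

Let pi_neq0 : pi != 0 :> R. Proof. by rewrite gt_eqF ?pi_gt0. Qed.

Lemma cofactor_poly_root (p q : 'I_L.+1) : p != q -> (Q p).[x q] = 0.
Proof.
move=> pq; apply/eqP; rewrite horner_prod (bigD1 q) 1?eq_sym //=.
by rewrite hornerXsubC subrr mul0r.
Qed.

Lemma cofactor_poly_sqr_ge (p : 'I_L.+1) :
  pi * L%:R / 2 <= cabs2 (Q p).[x p].
Proof.
have pL : (p <= L)%N by rewrite -ltnS.
apply: (le_trans (sin_prod_ge tau0 L0 tauL tauL1 taut0)).
have s0 : 0 <= sin_prod tau L.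
  by apply: prodr_ge0 => i _; rewrite mulr_ge0 // ltW // (sin_tau_gt0 tau0 tauL).
rewrite -(@lecR R) cabs2E norm_cofactor_poly -rmorphXn /= lecR.
have := sin_prod_split tau0 L0 tauL tauL1 pL.
by move=> H; rewrite ler_sqr ?nnegrE // (le_trans s0 H).
Qed.

Lemma rows_lagrange : rows_mx *m lagrange_mx = 1%:M.
Proof.
apply/matrixP => p p'; rewrite !mxE.
(* The unimodular factor of [lagrange_mx] turns the row entries into powers of the rotated node. *)
under eq_bigr => j _.
  rewrite !mxE mulrA -cisD.
  rewrite (_ : _ + _ = tau * (2 * (lift m p)%:R - L%:R) * j%:R); last by ring.
  rewrite cisMn -/(node tau L _) mulrA (mulrC (_ ^+ _)).
  over.
(* The leading terms cancel, so the [L] coefficients summed here give the full value at the node. *)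
rewrite -mulr_suml -horner_coef_wide; last first.
  apply/leq_sizeP => j; rewrite leq_eqVlt coefB => /orP[/eqP <-|Lj].
    have lead q : (Q q)`_L = 1.
      by have /monicP := cofactor_poly_monic q; rewrite lead_coefE size_cofactor_poly.
    by rewrite !lead subrr.
  by rewrite !nth_default ?subrr // size_cofactor_poly.
rewrite hornerD hornerN (cofactor_poly_root (p := m)) ?neq_lift // subr0.
have [<-|pp'] := eqVneq p p'.
  rewrite divff // -normr_eq0; apply/eqP => H.
  have := cofactor_poly_sqr_ge (lift m p); rewrite -(@lecR R) cabs2E H expr0n /=.
  by rewrite lecR leNgt divr_gt0 // mulr_gt0 ?pi_gt0 ?ltr0n.
have ne : lift m p' != lift m p.
  by apply: contra_neq pp' => /lift_inj ->.
by rewrite (cofactor_poly_root ne) mul0r.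
Qed.

(** Two coefficients of modulus at most 2 give 16 after squaring, over a denominator of at least
    [pi * L / 2]. *)
Lemma lagrange_mx_le j p : cabs2 (lagrange_mx j p) <= 32 / (pi * L%:R).
Proof.
have D0 : 0 < pi * L%:R / 2 :> R by rewrite divr_gt0 // mulr_gt0 ?pi_gt0 ?ltr0n.
rewrite mxE cabs2M cabs2_cis mul1r.
have -> : 32 / (pi * L%:R) = 16 / (pi * L%:R / 2) :> R.
  by move: (pi : R) pi_neq0 => u un; field; rewrite L_neq0 un.
rewrite cabs2M cabs2V; apply: ler_pM; rewrite ?invr_ge0 ?cabs2_ge0 //.
- rewrite -(@lecR R) cabs2E (_ : 16%:C = 4 ^+ 2); last by rewrite rmorph_nat -natrX.
  rewrite lerXn2r ?nnegrE // coefB (le_trans (ler_normB _ _)) //.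
  rewrite (_ : 4 = 2 + 2); last by rewrite -natrD.
  by rewrite lerD // coef_cofactor_poly_le //; have := ltn_ord j; lia.
- have D1 := cofactor_poly_sqr_ge (lift m p).
  by rewrite lef_pV2 // posrE (lt_le_trans D0 D1).
Qed.

(** The inverse has [L^2] entries of squared modulus at most [32 / (pi * L)], whence the factor
    [32 * L / pi]. A right inverse of a square matrix is also a left inverse. *)
Lemma rows_mx_lower (c : 'I_L -> R[i]) :
  \sum_j cabs2 (c j) <= (32 * L%:R / pi) *
    \sum_(p < L) cabs2 (\sum_(j < L) cis (2 * tau * (lift m p)%:R * j%:R) * c j).
Proof.
have LM : lagrange_mx *m rows_mx = 1%:M by apply: mulmx1C; exact: rows_lagrange.
pose d p := \sum_j rows_mx p j * c j.
have cE j : c j = \sum_p lagrange_mx j p * d p.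
  transitivity (\sum_j' (lagrange_mx *m rows_mx) j j' * c j').
    rewrite LM (bigD1 j) //= mxE eqxx mul1r big1 ?addr0 // => i ij.
    by rewrite mxE eq_sym (negbTE ij) mul0r.
  under eq_bigr do rewrite mxE mulr_suml.
  rewrite exchange_big; apply: eq_bigr => p _ /=; rewrite mulr_sumr.
  by apply: eq_bigr => i _; rewrite mulrA.
under eq_bigr do rewrite cE.
apply: (le_trans (frobenius_le _ lagrange_mx_le)).
rewrite le_eqVlt; apply/orP; left; apply/eqP; congr (_ * _).
  by move: (pi : R) pi_neq0 => u un; field; rewrite ?L_neq0 un.
by apply: eq_bigr => p _; congr cabs2; apply: eq_bigr => j _; rewrite mxE.
Qed.

Lemma rows_mx_dual_lower (w : 'I_L -> R[i]) :
  \sum_p cabs2 (w p) <= (32 * L%:R / pi) *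
    \sum_(j < L) cabs2 (\sum_(p < L) (cis (2 * tau * (lift m p)%:R * j%:R))^*%C * w p).
Proof.
pose d j := \sum_p (rows_mx p j)^*%C * w p.
have wE p : w p = \sum_j (lagrange_mx j p)^*%C * d j.
  transitivity (\sum_p' ((rows_mx *m lagrange_mx) p' p)^*%C * w p').
    rewrite rows_lagrange (bigD1 p) //= mxE eqxx conjc_nat mul1r big1 ?addr0 // => i ip.
    by rewrite mxE (negbTE ip) conjc_nat mul0r.
  under eq_bigr do rewrite mxE rmorph_sum mulr_suml.
  rewrite exchange_big; apply: eq_bigr => j _ /=; rewrite mulr_sumr.
  by apply: eq_bigr => i _; rewrite rmorphM mulrA; congr (_ * _); rewrite mulrC.
under eq_bigr do rewrite wE.
have H i j : cabs2 ((lagrange_mx j i)^*%C) <= 32 / (pi * L%:R).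
  by rewrite cabs2_conj lagrange_mx_le.
apply: (le_trans (frobenius_le _ H)).
rewrite le_eqVlt; apply/orP; left; apply/eqP; congr (_ * _).
  by move: (pi : R) pi_neq0 => u un; field; rewrite ?L_neq0 un.
by apply: eq_bigr => p _; congr cabs2; apply: eq_bigr => j _; rewrite mxE.
Qed.

End Interpolation.

(** * Square integrable complex functions *)

Section ComplexMeasurable.
Context {R : realType}.
Local Open Scope complex_scope.
Variable D : set R.
Hypothesis mD : measurable D.
Implicit Types f g : R -> R[i].
Local Notation mu := (@lebesgue_measure R).

Definition cmeasurable f :=
  measurable_fun D (fun x => complex.Re (f x)) /\
  measurable_fun D (fun x => complex.Im (f x)).

Lemma cmeasurable_cst (c : R[i]) : cmeasurable (fun=> c).
Proof. by split; exact: measurable_cst. Qed.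

Lemma cmeasurableD f g : cmeasurable f -> cmeasurable g ->
  cmeasurable (fun x => f x + g x).
Proof.
move=> [f1 f2] [g1 g2]; split; under eq_fun do rewrite raddfD /=;
  exact: measurable_funD.
Qed.

Lemma cmeasurableM f g : cmeasurable f -> cmeasurable g ->
  cmeasurable (fun x => f x * g x).
Proof.
move=> [f1 f2] [g1 g2]; split.
- rewrite (_ : (fun x => _) = (fun x => complex.Re (f x) * complex.Re (g x)
    - complex.Im (f x) * complex.Im (g x))); last first.
    by apply/funext => x; case: (f x) (g x) => [a b] [c d].
  by apply: measurable_funB; exact: measurable_funM.
- rewrite (_ : (fun x => _) = (fun x => complex.Re (f x) * complex.Im (g x)
    + complex.Im (f x) * complex.Re (g x))); last first.
    by apply/funext => x; case: (f x) (g x) => [a b] [c d].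
  by apply: measurable_funD; exact: measurable_funM.
Qed.

Lemma cmeasurable_conj f : cmeasurable f -> cmeasurable (fun x => (f x)^*%C).
Proof.
move=> [f1 f2]; split.
- rewrite (_ : (fun x => _) = (fun x => complex.Re (f x))) //.
  by apply/funext => x; case: (f x).
- rewrite (_ : (fun x => _) = (fun x => - complex.Im (f x))).
    exact: measurable_funN.
  by apply/funext => x; case: (f x).
Qed.

Lemma cmeasurableN f : cmeasurable f -> cmeasurable (fun x => - f x).
Proof.
move=> mf; rewrite (_ : (fun x => _) = (fun x => -1 * f x)).
  exact: (cmeasurableM (cmeasurable_cst _)).
by apply/funext => x; rewrite mulN1r.
Qed.

Lemma cmeasurableB f g : cmeasurable f -> cmeasurable g ->
  cmeasurable (fun x => f x - g x).
Proof. by move=> mf mg; apply: cmeasurableD => //; exact: cmeasurableN. Qed.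

Lemma cmeasurable_sum (I : Type) (s : seq I) (P : pred I) (F : I -> R -> R[i]) :
  (forall i, P i -> cmeasurable (F i)) ->
  cmeasurable (fun x => \sum_(i <- s | P i) F i x).
Proof.
move=> mF; elim: s => [|i s IH].
  rewrite (_ : (fun x => _) = (fun=> 0)); first exact: cmeasurable_cst.
  by apply/funext => x; rewrite big_nil.
rewrite (_ : (fun x => _) = (fun x => if P i then F i x + \sum_(j <- s | P j) F j x
    else \sum_(j <- s | P j) F j x)); last by apply/funext => x; rewrite big_cons.
by case Pi: (P i) => //; apply: cmeasurableD => //; exact: mF.
Qed.

Lemma measurable_cabs2 f : cmeasurable f -> measurable_fun D (fun x => cabs2 (f x)).
Proof. by move=> [f1 f2]; apply: measurable_funD; exact: measurable_funX. Qed.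

Lemma measurable_cabs2_EFin f : cmeasurable f ->
  measurable_fun D (fun x => (cabs2 (f x))%:E).
Proof. by move=> mf; apply/measurable_EFinP; exact: measurable_cabs2. Qed.

(** Stands in for the triangle inequality, so that only squared norms occur; the factor 2 is
    harmless for membership and density. *)
Lemma cabs2D_le (z w : R[i]) : cabs2 (z + w) <= 2 * cabs2 z + 2 * cabs2 w.
Proof.
case: z w => [a b] [c d]; rewrite /cabs2 /=.
have := sqr_ge0 (a - c); have := sqr_ge0 (b - d); nra.
Qed.

Lemma L2norm2_ge0 f : (0 <= L2norm2 D f)%E.
Proof. by apply: integral_ge0 => x _; rewrite lee_fin cabs2_ge0. Qed.

Lemma L2norm2D_le f g : cmeasurable f -> cmeasurable g ->
  (L2norm2 D (fun x => (f x + g x)%R) <= 2%:E * L2norm2 D f + 2%:E * L2norm2 D g)%E.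
Proof.
move=> mf mg; rewrite /L2norm2.
rewrite -!ge0_integralZl //; try (by move=> x _; rewrite lee_fin cabs2_ge0);
  try exact: measurable_cabs2_EFin; rewrite ?lee_fin //.
rewrite -ge0_integralD //; last 4 first.
- by move=> x _; rewrite -EFinM lee_fin mulr_ge0 ?cabs2_ge0.
- by apply: measurable_funeM; exact: measurable_cabs2_EFin.
- by move=> x _; rewrite -EFinM lee_fin mulr_ge0 ?cabs2_ge0.
- by apply: measurable_funeM; exact: measurable_cabs2_EFin.
apply: ge0_le_integral => //.
- by move=> x _; rewrite lee_fin cabs2_ge0.
- by apply: measurable_cabs2_EFin; exact: cmeasurableD.
- by apply: emeasurable_funD; apply: measurable_funeM; exact: measurable_cabs2_EFin.
- by move=> x _; rewrite -!EFinM -EFinD lee_fin cabs2D_le.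
Qed.

Lemma L2norm2_normZ (c : R[i]) f : cmeasurable f ->
  L2norm2 D (fun x => c * f x) = ((cabs2 c)%:E * L2norm2 D f)%E.
Proof.
move=> mf; rewrite /L2norm2.
under eq_integral do rewrite cabs2M EFinM.
rewrite ge0_integralZl //; first exact: measurable_cabs2_EFin.
- by move=> x _; rewrite lee_fin cabs2_ge0.
- by rewrite lee_fin cabs2_ge0.
Qed.

Lemma L2P f : L2 D f <->
  cmeasurable f /\ mu.-integrable D (fun x => (cabs2 (f x))%:E).
Proof.
split.
- move=> [f1 f2 fin]; split=> //; apply/integrableP; split.
    exact: measurable_cabs2_EFin.
  by under eq_integral do rewrite gee0_abs ?lee_fin ?cabs2_ge0 //.
- move=> [[f1 f2] /integrableP[_]].
  by under eq_integral do rewrite gee0_abs ?lee_fin ?cabs2_ge0 //; split.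
Qed.

Lemma L2_cmeasurable f : L2 D f -> cmeasurable f.
Proof. by move=> []. Qed.

Lemma L2D f g : L2 D f -> L2 D g -> L2 D (fun x => f x + g x).
Proof.
move=> lf lg; have mf := L2_cmeasurable lf; have mg := L2_cmeasurable lg.
have [m1 m2] := cmeasurableD mf mg; split=> //.
apply: (le_lt_trans (L2norm2D_le mf mg)); rewrite lte_add_pinfty //.
  by case: lf => _ _ ?; rewrite lte_mul_pinfty.
by case: lg => _ _ ?; rewrite lte_mul_pinfty.
Qed.

Lemma L2Z (c : R[i]) f : L2 D f -> L2 D (fun x => c * f x).
Proof.
move=> lf; have mf := L2_cmeasurable lf.
have [m1 m2] := cmeasurableM (cmeasurable_cst c) mf; split=> //.
case: lf => _ _ fin.
by rewrite L2norm2_normZ // lte_mul_pinfty // lee_fin cabs2_ge0.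
Qed.

Lemma L2N f : L2 D f -> L2 D (fun x => - f x).
Proof.
move=> lf; rewrite (_ : (fun x => _) = (fun x => -1 * f x)); first exact: L2Z.
by apply/funext => x; rewrite mulN1r.
Qed.

Lemma L2B f g : L2 D f -> L2 D g -> L2 D (fun x => f x - g x).
Proof. by move=> lf lg; apply: L2D => //; exact: L2N. Qed.

Lemma L2_0 : L2 D (fun=> 0).
Proof.
split; try exact: measurable_cst.
rewrite /L2norm2; under eq_integral do rewrite /cabs2 /= expr0n addr0.
by rewrite integral0.
Qed.

Lemma L2_sum (I : eqType) (s : seq I) (F : I -> R -> R[i]) :
  (forall i, i \in s -> L2 D (F i)) -> L2 D (fun x => \sum_(i <- s) F i x).
Proof.
elim: s => [|i s IH] lF.
  rewrite (_ : (fun x => _) = (fun=> 0)); first exact: L2_0.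
  by apply/funext => x; rewrite big_nil.
rewrite (_ : (fun x => _) = (fun x => F i x + \sum_(j <- s) F j x)); last first.
  by apply/funext => x; rewrite big_cons.
apply: L2D; first by apply: lF; rewrite mem_head.
by apply: IH => j js; apply: lF; rewrite in_cons js orbT.
Qed.

Lemma L2_bounded f (M : R) : cmeasurable f -> (mu D < +oo)%E ->
  (forall x, D x -> cabs2 (f x) <= M) -> L2 D f.
Proof.
move=> mf Dfin fM; apply/L2P; split=> //.
apply: (@measurable_bounded_integrable _ _ _ mu (fun x => cabs2 (f x))) => //.
  exact: measurable_cabs2.
by exists M; split=> [|y My x Dx /=]; rewrite ?num_real // ger0_norm ?cabs2_ge0 //
  (le_trans (fM x Dx)) // ltW.
Qed.

Lemma integrable_conjM f g : L2 D f -> L2 D g ->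
  mu.-integrable D (fun x => (complex.Re (f x * (g x)^*%C))%:E) /\
  mu.-integrable D (fun x => (complex.Im (f x * (g x)^*%C))%:E).
Proof.
move=> /L2P[mf lf] /L2P[mg lg].
have [m1 m2] := cmeasurableM mf (cmeasurable_conj mg).
have lfg : mu.-integrable D (fun x => (cabs2 (f x) + cabs2 (g x))%:E).
  by under eq_fun do rewrite EFinD; exact: integrableD.
have B x : `|complex.Re (f x * (g x)^*%C)| <= `|cabs2 (f x) + cabs2 (g x)| /\
   `|complex.Im (f x * (g x)^*%C)| <= `|cabs2 (f x) + cabs2 (g x)|.
  rewrite (ger0_norm (addr_ge0 (cabs2_ge0 (f x)) (cabs2_ge0 (g x)))).
  have sq (u v : R) : `|u * v| <= u ^+ 2 + v ^+ 2.
    rewrite ler_norml; have := sqr_ge0 (u - v); have := sqr_ge0 (u + v).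
    by move=> h1 h2; apply/andP; split; nra.
  have sq2 (u v w z : R) : `|u * v + w * z| <= u ^+ 2 + w ^+ 2 + (v ^+ 2 + z ^+ 2).
    by rewrite (le_trans (ler_normD _ _)) // addrACA lerD.
  case: (f x) (g x) => [a b] [c d]; rewrite /cabs2 /=; split.
    by apply: le_trans (sq2 a c b d); rewrite mulrN opprK.
  by apply: le_trans (sq2 a (- d) b c) _; rewrite sqrrN (addrC (d ^+ 2)).
split; apply: (@le_integrable _ _ _ mu D mD _
  (fun x => (cabs2 (f x) + cabs2 (g x))%:E)) => //.
- exact/measurable_EFinP.
- by move=> x _; rewrite lee_fin; case: (B x).
- exact/measurable_EFinP.
- by move=> x _; rewrite lee_fin; case: (B x).
Qed.

Local Notation dot := (L2dot D).

Lemma L2dot_mulE f g (k : R -> R[i]) : (forall x, D x -> f x * (g x)^*%C = k x) ->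
  dot f g = Complex (\int[mu]_(x in D) complex.Re (k x))%R
                    (\int[mu]_(x in D) complex.Im (k x))%R.
Proof.
move=> fgk; rewrite /L2dot; congr Complex; apply: eq_Rintegral => x;
  by rewrite inE => Dx; rewrite fgk.
Qed.

Lemma L2dot0l g : dot (fun=> 0) g = 0.
Proof.
rewrite (@L2dot_mulE _ _ (fun=> 0)) => [|x _]; last by rewrite mul0r.
by rewrite /= Rintegral_cst // mul0r.
Qed.

Lemma L2dotDl f g h : L2 D f -> L2 D g -> L2 D h ->
  dot (fun x => f x + g x) h = dot f h + dot g h.
Proof.
move=> lf lg lh.
have [a1 a2] := integrable_conjM lf lh; have [b1 b2] := integrable_conjM lg lh.
rewrite /L2dot; apply/eqP; rewrite eq_complex /=; apply/andP; split; apply/eqP.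
- rewrite -RintegralD //; apply: eq_Rintegral => x _.
  by rewrite mulrDl raddfD.
- rewrite -RintegralD //; apply: eq_Rintegral => x _.
  by rewrite mulrDl raddfD.
Qed.

Lemma L2dotZl (c : R[i]) f h : L2 D f -> L2 D h ->
  dot (fun x => c * f x) h = c * dot f h.
Proof.
move=> lf lh; have [a1 a2] := integrable_conjM lf lh.
have Z1 k : mu.-integrable D (fun x => (k * complex.Re (f x * (h x)^*%C))%:E).
  by under eq_fun do rewrite EFinM; exact: integrableZl.
have Z2 k : mu.-integrable D (fun x => (k * complex.Im (f x * (h x)^*%C))%:E).
  by under eq_fun do rewrite EFinM; exact: integrableZl.
case: c => a b; rewrite /L2dot; apply/eqP; rewrite eq_complex /=.
apply/andP; split; apply/eqP.
- rewrite -!RintegralZl // -RintegralB; [|exact: mD|exact: Z1|exact: Z2].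
  by apply: eq_Rintegral => x _; rewrite -mulrA; case: (f x * _).
- rewrite -!RintegralZl // -RintegralD; [|exact: mD|exact: Z2|exact: Z1].
  by apply: eq_Rintegral => x _; rewrite -mulrA; case: (f x * _).
Qed.

Lemma L2dotC f g : L2 D f -> L2 D g -> dot g f = (dot f g)^*%C.
Proof.
move=> lf lg; have [a1 a2] := integrable_conjM lf lg.
rewrite /L2dot /=; congr Complex.
  by apply: eq_Rintegral => x _; case: (f x) (g x) => [a b] [c d] /=; ring.
rewrite -mulN1r -RintegralZl //.
by apply: eq_Rintegral => x _; case: (f x) (g x) => [a b] [c d] /=; ring.
Qed.

Lemma L2dot_self f : L2 D f ->
  L2norm2 D f = (complex.Re (dot f f))%:E /\ complex.Im (dot f f) = 0.
Proof.
move=> /L2P[mf lf]; rewrite /L2dot /=; split.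
- rewrite /L2norm2 -[LHS]fineK; last exact: integrable_fin_num.
  by congr EFin; apply: eq_Rintegral => x _; rewrite cabs2_normc.
- under eq_Rintegral => x _.
    rewrite (_ : complex.Im _ = 0); last by case: (f x) => a b /=; ring.
    over.
  by rewrite Rintegral_cst // mul0r.
Qed.

Lemma L2dot_sum (I : eqType) (s : seq I) (F : I -> R -> R[i]) h :
  (forall i, i \in s -> L2 D (F i)) -> L2 D h ->
  dot (fun x => \sum_(i <- s) F i x) h = \sum_(i <- s) dot (F i) h.
Proof.
move=> + lh; elim: s => [|i s IH] lF.
  rewrite (_ : (fun x => _) = (fun=> 0)); last by apply/funext => x; rewrite big_nil.
  rewrite big_nil /L2dot; apply/eqP; rewrite eq_complex /=.
  under eq_Rintegral do rewrite mul0r.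
  rewrite /= Rintegral_cst // mul0r eqxx /=.
  under eq_Rintegral do rewrite mul0r.
  by rewrite /= Rintegral_cst // mul0r.
have lFs : forall j, j \in s -> L2 D (F j).
  by move=> j js; apply: lF; rewrite in_cons js orbT.
rewrite (_ : (fun x => _) = (fun x => F i x + \sum_(j <- s) F j x)); last first.
  by apply/funext => x; rewrite big_cons.
rewrite L2dotDl //; last 2 first.
- by apply: lF; rewrite mem_head.
- exact: L2_sum.
by rewrite big_cons IH.
Qed.

End ComplexMeasurable.

(** * Finite orthonormal families *)

Section Bessel.
Context {R : realType}.
Local Open Scope complex_scope.
Variable D : set R.
Hypothesis mD : measurable D.
Local Notation dot := (L2dot D).
Variables (I : eqType) (e : I -> R -> R[i]) (s : seq I).
Hypothesis us : uniq s.
Hypothesis le : forall i, i \in s -> L2 D (e i).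
Hypothesis orth : forall i j, i \in s -> j \in s -> dot (e i) (e j) = (i == j)%:R.

Lemma orthonormal_dot (c : I -> R[i]) k : k \in s ->
  dot (fun x => \sum_(i <- s) c i * e i x) (e k) = c k.
Proof.
move=> ks; rewrite L2dot_sum //; last 2 first.
- by move=> i si; apply: L2Z => //; exact: le.
- exact: le.
rewrite (bigD1_seq k) //= L2dotZl //; try exact: le.
rewrite orth // eqxx mulr1 big_seq_cond big1 ?addr0 // => i /andP[si ik].
by rewrite L2dotZl //; try exact: le; rewrite orth // (negbTE ik) mulr0.
Qed.

(** Completing the square. The choice [c i = dot h (e i)] gives Bessel's inequality, arbitrary [c]
    give [bessel_approx], and [h = 0] gives the norm of a combination. *)
Lemma bessel_identity (h : R -> R[i]) (c : I -> R[i]) : L2 D h ->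
  L2norm2 D (fun x => h x - \sum_(i <- s) c i * e i x)
  = (complex.Re (dot h h) - \sum_(i <- s) cabs2 (dot h (e i))
     + \sum_(i <- s) cabs2 (c i - dot h (e i)))%:E.
Proof.
move=> lh; pose T x := \sum_(i <- s) c i * e i x.
have lT : L2 D T by apply: L2_sum => // i si; apply: L2Z => //; exact: le.
have dT g : L2 D g -> dot T g = \sum_(i <- s) c i * (dot g (e i))^*%C.
  move=> lg; rewrite L2dot_sum //; last by move=> i si; apply: L2Z => //; exact: le.
  rewrite big_seq [RHS]big_seq; apply: eq_bigr => i si.
  by rewrite L2dotZl //; [rewrite (L2dotC mD lg (le si))| exact: le].
have [-> _] := L2dot_self mD (L2B mD lh lT).
congr (_%:E).
have dB f g : L2 D f -> L2 D g -> dot (fun x => f x - T x) g = dot f g - dot T g.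
  move=> lf lg.
  rewrite (_ : (fun x => _) = (fun x => f x + (-1) * T x)); last first.
    by apply/funext => x; rewrite mulN1r.
  by rewrite L2dotDl // ?L2dotZl ?mulN1r //; exact: L2Z.
rewrite -/T dB //; last exact: L2B.
rewrite (L2dotC mD (L2B mD lh lT) lh) (L2dotC mD (L2B mD lh lT) lT) !dB //.
have ReJ (z : R[i]) : complex.Re z^*%C = complex.Re z by case: z.
have X3 : dot T T = \sum_(i <- s) c i * (c i)^*%C.
  rewrite dT // big_seq [RHS]big_seq; apply: eq_bigr => i si.
  by rewrite -(L2dotC mD lT (le si)) (L2dotC mD lT (le si)) orthonormal_dot.
have ReB (z w : R[i]) : complex.Re (z - w) = complex.Re z - complex.Re w.
  by case: z w => [? ?] [? ?].
have ReS (F : I -> R[i]) : complex.Re (\sum_(i <- s) F i) = \sum_(i <- s) complex.Re (F i).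
  exact: raddf_sum.
rewrite ReB !ReJ !ReB (L2dotC mD lT lh) ReJ X3 dT // !ReS.
rewrite -!addrA; congr (_ + _); rewrite opprB addrCA.
rewrite -!sumrN -!big_split; apply: eq_bigr => i _; cbv beta.
case: (dot h (e i)) (c i) => [a b] [a' b']; rewrite /cabs2 /=; ring.
Qed.

Lemma bessel_ineq (h : R -> R[i]) : L2 D h ->
  \sum_(i <- s) cabs2 (dot h (e i)) <= complex.Re (dot h h).
Proof.
move=> lh; rewrite -subr_ge0 -lee_fin.
have := bessel_identity (fun i => dot h (e i)) lh.
under [X in _ + X]eq_bigr do rewrite subrr.
rewrite [X in _ + X]big1 => [|i _]; last by rewrite /cabs2 /= expr0n addr0.
by rewrite addr0 => <-; exact: L2norm2_ge0.
Qed.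

Lemma bessel_approx (h : R -> R[i]) (c : I -> R[i]) : L2 D h ->
  (L2norm2 D h <= (\sum_(i <- s) cabs2 (dot h (e i)))%:E +
    L2norm2 D (fun x => (h x - \sum_(i <- s) c i * e i x)%R))%E.
Proof.
move=> lh; rewrite bessel_identity //; have [-> _] := L2dot_self mD lh.
rewrite -EFinD lee_fin.
have : 0 <= \sum_(i <- s) cabs2 (c i - dot h (e i)).
  by apply: sumr_ge0 => i _; exact: cabs2_ge0.
move: (\sum_(i <- s) _) (\sum_(i <- s) _) => u v; lra.
Qed.

Lemma L2norm2_orthonormal (c : I -> R[i]) :
  L2norm2 D (fun x => \sum_(i <- s) c i * e i x) = (\sum_(i <- s) cabs2 (c i))%:E.
Proof.
have := bessel_identity (fun i => - c i) (L2_0 D).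
rewrite L2dot0l // big1 => [|i _]; last by rewrite L2dot0l // /cabs2 /= expr0n addr0.
rewrite subrr add0r => H.
transitivity (L2norm2 D (fun x => 0 - \sum_(i <- s) - c i * e i x)).
  congr L2norm2; apply/funext => x; rewrite sub0r -sumrN.
  by apply: eq_bigr => i _; rewrite mulNr opprK.
rewrite H; congr (_%:E); apply: eq_bigr => i _.
by rewrite L2dot0l // subr0; case: (c i) => a b; rewrite /cabs2 /= !sqrrN.
Qed.

End Bessel.

(** * Exponentials on the unit interval *)

Section Exponentials.
Context {R : realType}.
Local Open Scope complex_scope.
Local Notation mu := (@lebesgue_measure R).

Lemma cexp2piE (lam x : R) : cexp2pi lam x = cis (2 * pi * lam * x).
Proof. by []. Qed.

Lemma continuous_cosZ (w : R) : continuous (fun x : R => cos (w * x)).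
Proof.
move=> x; apply: (@continuous_comp _ _ _ ( *%R w) cos); first exact: mulrl_continuous.
exact: continuous_cos.
Qed.

Lemma continuous_sinZ (w : R) : continuous (fun x : R => sin (w * x)).
Proof.
move=> x; apply: (@continuous_comp _ _ _ ( *%R w) sin); first exact: mulrl_continuous.
exact: continuous_sin.
Qed.

Lemma cmeasurable_cis (D : set R) (w : R) : measurable D ->
  cmeasurable D (fun x => cis (w * x)).
Proof.
move=> mD; split; apply: measurable_funTS; apply: continuous_measurable_fun.
- exact: continuous_cosZ.
- exact: continuous_sinZ.
Qed.

Lemma continuous_integrable_itv (f : R -> R) (a b : R) : continuous f ->
  mu.-integrable `[a, b[ (EFin \o f).
Proof.
move=> cf; apply: (@integrableS _ _ _ mu `[a, b]%classic) => //.
  by apply: subset_itvl; rewrite bnd_simp.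
apply: continuous_compact_integrable; first exact: segment_compact.
exact: continuous_subspaceT.
Qed.

Lemma Rintegral_FTC (f F : R -> R) (a b : R) : a < b -> continuous f ->
  (forall x : R, is_derive x 1 F (f x)) ->
  (\int[mu]_(x in `[a, b[) f x)%R = F b - F a.
Proof.
move=> ab cf dF.
have cF : continuous F.
  move=> x; apply: differentiable_continuous; apply/derivable1_diffP.
  by have [] := dF x.
rewrite Rintegral_itv_bndo_bndc; last exact: continuous_integrable_itv.
rewrite /Rintegral (@continuous_FTC2 _ f F) //.
- exact: continuous_subspaceT.
- split.
  + by move=> x _; have [] := dF x.
  + exact/cvg_at_right_filter/cF.
  + exact/cvg_at_left_filter/cF.
- by move=> x _; rewrite derive1E; have [] := dF x.
Qed.

Lemma Rintegral_cos (w a b : R) : w != 0 -> a < b ->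
  (\int[mu]_(x in `[a, b[) cos (w * x))%R = (sin (w * b) - sin (w * a)) / w.
Proof.
move=> w0 ab.
have dF (x : R) : is_derive x 1 (fun x => w^-1 * sin (w * x)) (cos (w * x)).
  by apply: is_derive_eq; rewrite /GRing.scale /=; field; exact: w0.
by rewrite (Rintegral_FTC ab (@continuous_cosZ w) dF); field.
Qed.

Lemma Rintegral_sin (w a b : R) : w != 0 -> a < b ->
  (\int[mu]_(x in `[a, b[) sin (w * x))%R = (cos (w * a) - cos (w * b)) / w.
Proof.
move=> w0 ab.
have dF (x : R) : is_derive x 1 (fun x => - (w^-1 * cos (w * x))) (sin (w * x)).
  by apply: is_derive_eq; rewrite /GRing.scale /=; field; exact: w0.
by rewrite (Rintegral_FTC ab (@continuous_sinZ w) dF); field.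
Qed.

Lemma cis_2pi_int (k : int) : cis (2 * pi * k%:~R : R) = 1.
Proof.
have c1 : cis (2 * pi : R) = 1.
  by rewrite /cis mulr_natl cos2pi sin2pi.
case: k => n.
  by rewrite -pmulrn cisMn c1 expr1n.
by rewrite NegzE rmorphN /= mulrN cisN -pmulrn cisMn c1 expr1n conjc1.
Qed.

Local Notation D := (`[0%R, 1%R[%classic : set R).

Lemma mu_unit : mu D = 1%E.
Proof. by rewrite lebesgue_measure_itv /= lte_fin ltr01 sube0. Qed.

Lemma L2_cexp2pi (lam : R) : L2 D (cexp2pi lam).
Proof.
apply: (@L2_bounded _ _ _ _ 1) => //.
- exact: cmeasurable_cis.
- by rewrite mu_unit ltry.
- by move=> x _; rewrite cexp2piE cabs2_cis.
Qed.

Lemma cexp2pi_orthonormal (m n : int) :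
  L2dot D (cexp2pi m%:~R) (cexp2pi n%:~R) = (m == n)%:R :> R[i].
Proof.
have E x : cexp2pi m%:~R x * (cexp2pi n%:~R x)^*%C = cis (2 * pi * (m - n)%:~R * x) :> R[i].
  by rewrite !cexp2piE -cisN -cisD -mulNr -mulrDl -mulrN -mulrDr rmorphB.
have [->|mn] := eqVneq m n.
  rewrite (@L2dot_mulE _ _ _ _ (fun=> 1)) => [|x _].
    rewrite /= !Rintegral_cst // mul1r mul0r; congr Complex; exact: (congr1 fine mu_unit).
  by rewrite !cexp2piE -cisN -cisD subrr cis0.
rewrite (L2dot_mulE (fun x _ => E x)).
pose w : R := 2 * pi * (m - n)%:~R.
have w0 : w != 0.
  by rewrite /w mulf_neq0 ?intr_eq0 ?subr_eq0 // mulf_neq0 ?gt_eqF ?pi_gt0.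
have [c1 s0] : cos w = 1 /\ sin w = 0 by have [] := cis_2pi_int (m - n).
by rewrite /= Rintegral_cos // Rintegral_sin // !mulr1 !mulr0 sin0 s0 cos0 c1 !subrr !mul0r.
Qed.

End Exponentials.

(** * Density of trigonometric polynomials and Parseval's identity *)

Section CosineKernel.
Context {R : realType}.
Local Open Scope complex_scope.

Definition trig (s : seq (R[i] * int)) (x : R) : R[i] :=
  \sum_(p <- s) p.1 * cexp2pi p.2%:~R x.

Definition is_trig (f : R -> R[i]) := exists s, f = trig s.

Lemma is_trigD f g : is_trig f -> is_trig g -> is_trig (fun x => f x + g x).
Proof.
by move=> [s ->] [t ->]; exists (s ++ t); apply/funext => x; rewrite /trig big_cat.
Qed.

Lemma is_trigZ c f : is_trig f -> is_trig (fun x => c * f x).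
Proof.
move=> [s ->]; exists [seq (c * p.1, p.2) | p <- s]; apply/funext => x.
by rewrite /trig big_map mulr_sumr; apply: eq_bigr => p _; rewrite mulrA.
Qed.

Lemma is_trig_sum (n : nat) (F : 'I_n -> R -> R[i]) :
  (forall i, is_trig (F i)) -> is_trig (fun x => \sum_i F i x).
Proof.
elim: n F => [|n IH] F tF.
  by exists [::]; apply/funext => x; rewrite big_ord0 /trig big_nil.
rewrite (_ : (fun x => _) = (fun x => \sum_i F (widen_ord (leqnSn n) i) x + F ord_max x)).
  by apply: is_trigD => //; apply: IH.
by apply/funext => x; rewrite big_ord_recr.
Qed.

Lemma is_trig_exp (k : int) : is_trig (cexp2pi k%:~R).
Proof.
exists [:: (1, k)]; apply/funext => x.
by rewrite /trig big_seq1 mul1r.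
Qed.

(** The de la Vallee-Poussin kernel before normalisation: a nonnegative trigonometric polynomial of
    degree [n] that concentrates at the integers. *)
Definition cos_kernel (n : nat) (t : R) : R := (2 * cos (pi * t)) ^+ (2 * n).

Lemma cos_kernel_ge0 n t : 0 <= cos_kernel n t.
Proof. by rewrite /cos_kernel mulnC exprM sqr_ge0. Qed.

Lemma cos_kernelE n t : (cos_kernel n t)%:C =
  \sum_(i < (2 * n).+1) cexp2pi (n%:Z - i%:Z)%:~R t *+ 'C(2 * n, i).
Proof.
rewrite /cos_kernel rmorphXn /=.
have -> : (2 * cos (pi * t))%:C = cis (pi * t) + cis (- (pi * t)).
  by have := cisD_cos 0 (pi * t); rewrite add0r sub0r cis0 mul1r => ->.
rewrite exprDn; apply: eq_bigr => i _; congr (_ *+ _).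
have i2n : (i <= 2 * n)%N by rewrite -ltnS.
rewrite -!cisMn -cisD cexp2piE; congr cis.
rewrite natrB // rmorphB /= natrM -!pmulrn; ring.
Qed.

Lemma sum_cis_root (q : nat) (k : int) : (`|k| < q)%N -> k != 0 ->
  \sum_(j < q) cexp2pi k%:~R (j%:R / q%:R) = 0 :> R[i].
Proof.
move=> kq k0.
have q0 : 0 < q%:R :> R by rewrite ltr0n; exact: leq_ltn_trans kq.
pose z : R[i] := cis (2 * pi * k%:~R / q%:R).
have zE j : cexp2pi k%:~R (j%:R / q%:R) = z ^+ j.
  by rewrite cexp2piE /z -cisMn; congr cis; field; rewrite gt_eqF.
under eq_bigr do rewrite zE.
have zq : z ^+ q = 1.
  by rewrite -cisMn mulfVK ?gt_eqF // cis_2pi_int.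
have z1 : z - 1 != 0.
  pose w : R := pi * k%:~R / q%:R.
  have -> : z - 1 = cis (w + w) - cis (w - w).
    by rewrite subrr cis0 /z /w; congr (cis _ - _); field; rewrite gt_eqF.
  rewrite cisB_sin mulf_neq0 ?cis_neq0 // eq_complex /= negb_and mulf_neq0 ?orbT //.
  rewrite -normr_eq0 (_ : `|sin w| = sin `|w|).
    rewrite gt_eqF // sin_gt0_pi // /w !normrM normfV (gtr0_norm q0) (gtr0_norm (pi_gt0 R)).
    rewrite -intr_norm divr_gt0 ?mulr_gt0 ?pi_gt0 ?ltr0z ?normr_gt0 //=.
    rewrite ltr_pdivrMr // ltr_pM2l ?pi_gt0 // -abszE -pmulrn ltr_nat //.
  have wpi : `|w| <= pi.
    rewrite /w !normrM normfV (gtr0_norm q0) (gtr0_norm (pi_gt0 R)) -intr_norm.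
    rewrite ler_pdivrMr // ler_pM2l ?pi_gt0 // -abszE -pmulrn ler_nat ltnW //.
  have s0 : 0 <= sin `|w| by apply: sin_ge0_pi; rewrite normr_ge0.
  have [h|h] := leP 0 w; first by rewrite (ger0_norm h) in s0 *; rewrite ger0_norm.
  by rewrite (ltr0_norm h) in s0 *; rewrite sinN in s0 *; rewrite ler0_norm // -oppr_ge0.
by have := subrX1 z q; rewrite zq subrr => /esym/eqP; rewrite mulf_eq0 (negbTE z1) => /eqP.
Qed.

(** Averaging over [n + 1] equispaced points is exact for trigonometric polynomials of degree at
    most [n], so only the constant term, the central binomial coefficient, survives. *)
Lemma sum_cos_kernel n (x : R) :
  \sum_(j < n.+1) cos_kernel n (x - j%:R / n.+1%:R) = n.+1%:R * 'C(2 * n, n)%:R.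
Proof.
apply: complexI; rewrite rmorph_sum /=.
under eq_bigr do rewrite cos_kernelE.
rewrite exchange_big /=.
have n2 : (n < (2 * n).+1)%N by lia.
rewrite (bigD1 (Ordinal n2)) //= [X in _ + X]big1 ?addr0; last first.
  move=> i; rewrite -val_eqE /= => i_n.
  have i2 := ltn_ord i.
  under eq_bigr => j _.
    rewrite (_ : cexp2pi _ _ = cexp2pi (n%:Z - i%:Z)%:~R x *
        cexp2pi (i%:Z - n%:Z)%:~R (j%:R / n.+1%:R)).
      over.
    rewrite !cexp2piE -cisD; congr cis; rewrite !rmorphB /=; ring.
  under eq_bigr do rewrite -mulrnAr.
  rewrite -mulr_sumr sumrMnl sum_cis_root ?mul0rn ?mulr0 //; lia.
under eq_bigr do rewrite subrr cexp2piE mulr0 mul0r cis0.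
rewrite sumr_const card_ord rmorphM /= !rmorph_nat.
by rewrite mulr_natl.
Qed.

(** At [x = 0] the term [j = 0] of the preceding sum is [4 ^ n], and the others are nonnegative. *)
Lemma central_bin_ge n : (4 ^+ n : R) <= n.+1%:R * 'C(2 * n, n)%:R.
Proof.
rewrite -(sum_cos_kernel n 0) (bigD1 ord0) //= mul0r subr0.
rewrite /cos_kernel mulr0 cos0 mulr1 exprM (_ : 2 ^+ 2 = 4 :> R) ?lerDl; last by ring.
by apply: sumr_ge0 => i _; exact: cos_kernel_ge0.
Qed.

(** A quadrature version of convolution with the kernel: only finitely many samples of [g] enter, so
    the result is a trigonometric polynomial, and the weights are nonnegative with sum exactly 1. *)
Definition trig_sampling (g : R -> R) (n : nat) (x : R) : R :=
  \sum_(j < n.+1) g (j%:R / n.+1%:R) *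
    (cos_kernel n (x - j%:R / n.+1%:R) / (n.+1%:R * 'C(2 * n, n)%:R)).

Lemma is_trig_sampling g n : is_trig (fun x => (trig_sampling g n x)%:C).
Proof.
rewrite (_ : (fun x => _) = (fun x => \sum_(j < n.+1) \sum_(i < (2 * n).+1)
   ((g (j%:R / n.+1%:R) / (n.+1%:R * 'C(2 * n, n)%:R))%:C *
    (cexp2pi (i%:Z - n%:Z)%:~R (j%:R / n.+1%:R) *+ 'C(2 * n, i))) *
    cexp2pi (n%:Z - i%:Z)%:~R x)).
  apply: is_trig_sum => j; apply: is_trig_sum => i; apply: is_trigZ.
  exact: is_trig_exp.
apply/funext => x; rewrite /trig_sampling rmorph_sum /=; apply: eq_bigr => j _.
rewrite mulrCA mulrC rmorphM /= cos_kernelE mulr_sumr; apply: eq_bigr => i _.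
rewrite -mulrA; congr (_ * _); rewrite [RHS]mulrnAl; congr (_ *+ _).
by rewrite !cexp2piE -cisD; congr cis; rewrite !rmorphB /=; ring.
Qed.

End CosineKernel.

(** * Pointwise convergence of the sampling operators *)

Section SamplingConvergence.
Context {R : realType}.
Implicit Types x rho e : R.

(** With [h = 1 - rho], Bernoulli gives [(n + 1) h <= (1 + h)^n], and [rho (1 + h) <= 1], so
    [rho^n (n + 1) h <= 1]. Squaring leaves a spare factor [n + 1], hence the threshold
    [1 / (e h^2)]. *)
Lemma pow_decay rho e : 0 <= rho -> rho < 1 -> 0 < e ->
  exists k, forall n, (k <= n)%N -> n.+1%:R * rho ^+ (2 * n) <= e.
Proof.
move=> r0 r1 e0; pose h := 1 - rho.
have h0 : 0 < h by rewrite subr_gt0.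
have h1 : h <= 1 by rewrite lerBlDr lerDl.
have bern n : 1 + n%:R * h <= (1 + h) ^+ n.
  elim: n => [|n IH]; first by rewrite mul0r addr0.
  rewrite exprS; apply: le_trans (ler_wpM2l _ IH); last by rewrite addr_ge0 // ltW.
  have := ler0n R n; rewrite -natr1; move: (n%:R : R) => u u0.
  have := mulr_ge0 u0 (sqr_ge0 h).
  by move=> H; rewrite -subr_ge0 (_ : _ - _ = u * h ^+ 2) //; ring.
have step n : rho ^+ n * (n.+1%:R * h) <= 1.
  apply: (@le_trans _ _ (rho ^+ n * (1 + h) ^+ n)).
    rewrite ler_wpM2l ?exprn_ge0 // (le_trans _ (bern n)) //.
    by rewrite -natr1 mulrDl mul1r addrC lerD2r.
  rewrite -exprMn; apply: exprn_ile1; first by rewrite mulr_ge0 // addr_ge0 // ltW.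
  by rewrite -subr_ge0 /h (_ : 1 - _ = (1 - rho) ^+ 2) ?sqr_ge0 //; ring.
exists (Num.truncn (e^-1 * h ^- 2)).+1 => n kn.
have n1 : e^-1 * h ^- 2 <= n.+1%:R.
  apply: (@le_trans _ _ (Num.truncn (e^-1 * h ^- 2)).+1%:R).
    by rewrite ltW // truncnS_gt.
  by rewrite ler_nat (leq_trans kn).
have s0 : 0 <= rho ^+ n * (n.+1%:R * h) by rewrite mulr_ge0 ?exprn_ge0 // mulr_ge0 // ltW.
have s2 : (rho ^+ n * (n.+1%:R * h)) ^+ 2 <= 1 by rewrite exprn_ile1.
have p0 : 0 < n.+1%:R * h ^+ 2 by rewrite mulr_gt0 // exprn_gt0.
rewrite -(ler_pM2r p0).
apply: (@le_trans _ _ 1).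
  apply: le_trans s2; rewrite mulnC exprM le_eqVlt; apply/orP; left; apply/eqP.
  by move: (rho ^+ n) => r; ring.
have := ler_wpM2r (ltW (mulr_gt0 e0 (exprn_gt0 2 h0))) n1.
rewrite (_ : e^-1 * h ^- 2 * _ = 1); last by field; rewrite !gt_eqF.
by rewrite mulrCA.
Qed.

Lemma abs_cos_far d t : 0 < d -> d <= `|t| -> `|t| <= 1 - d ->
  `|cos (pi * t)| <= cos (pi * d) :> R.
Proof.
move=> d0 dt td; have p0 := pi_gt0 R.
have d1 : d <= 1 by rewrite (le_trans dt) // (le_trans td) // gerDl oppr_le0 ltW.
have -> : cos (pi * t) = cos (pi * `|t|).
  have [h|h] := leP 0 t; first by rewrite ger0_norm.
  by rewrite ltr0_norm // mulrN cosN.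
rewrite ler_norml; apply/andP; split.
  have -> : - cos (pi * d) = cos (pi * (1 - d)).
    by rewrite mulrBr mulr1 addrC cosDpi cosN.
  apply: ler_cos; first by rewrite mulr_ge0 // ltW.
    by rewrite ler_pM2l.
  by rewrite ger_pMr // gerDl oppr_le0 ltW.
apply: ler_cos; first by rewrite mulr_ge0 // ltW.
  by rewrite ler_pM2l.
by rewrite ger_pMr // (le_trans td) // gerDl oppr_le0 ltW.
Qed.

Lemma trig_sampling_weights n x :
  (\sum_(j < n.+1) cos_kernel n (x - j%:R / n.+1%:R) / (n.+1%:R * 'C(2 * n, n)%:R) = 1) *
  (forall t : R, 0 <= cos_kernel n t / (n.+1%:R * 'C(2 * n, n)%:R)).
Proof.
have q0 : 0 < n.+1%:R * 'C(2 * n, n)%:R :> R.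
  by rewrite (lt_le_trans _ (central_bin_ge n)) // exprn_gt0.
split; first by rewrite -mulr_suml sum_cos_kernel divff // gt_eqF.
by move=> t; rewrite divr_ge0 ?cos_kernel_ge0 // ltW.
Qed.

Lemma trig_sampling_le (g : R -> R) M n x : (forall y, `|g y| <= M) ->
  `|trig_sampling g n x| <= M.
Proof.
move=> gM; have [w1 w0] := trig_sampling_weights n x.
rewrite /trig_sampling (le_trans (ler_norm_sum _ _ _)) //.
apply: (@le_trans _ _ (\sum_(j < n.+1) M *
  (cos_kernel n (x - j%:R / n.+1%:R) / (n.+1%:R * 'C(2 * n, n)%:R)))).
  by apply: ler_sum => j _; rewrite normrM [X in _ * X]ger0_norm // ler_wpM2r.
by rewrite -mulr_sumr w1 mulr1.
Qed.

(** Samples within [d] of [x] contribute at most [e] in the weighted mean. Each of the others has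
    weight at most [cos (pi * d) ^ (2 n)] by [central_bin_ge], and there are at most [n + 1] of
    them. The bounds [d <= x] and [d <= 1 - x] keep them away from [x] modulo 1 as well. *)
Lemma trig_sampling_dist (g : R -> R) M e d n x :
  (forall y, `|g y| <= M) -> 0 < d -> d <= x -> d <= 1 - x ->
  (forall y, `|y - x| < d -> `|g y - g x| <= e) -> 0 <= e ->
  `|trig_sampling g n x - g x| <= e + 2 * M * (n.+1%:R * cos (pi * d) ^+ (2 * n)).
Proof.
move=> gM d0 dx dx1 ge e0; have [w1 w0] := trig_sampling_weights n x.
have M0 : 0 <= M by rewrite (le_trans _ (gM 0)).
have q0 : 0 < n.+1%:R * 'C(2 * n, n)%:R :> R.
  by rewrite (lt_le_trans _ (central_bin_ge n)) // exprn_gt0.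
pose w (j : 'I_n.+1) : R := cos_kernel n (x - j%:R / n.+1%:R) / (n.+1%:R * 'C(2 * n, n)%:R).
have -> : trig_sampling g n x - g x = \sum_(j < n.+1) (g (j%:R / n.+1%:R) - g x) * w j.
  under eq_bigr do rewrite mulrBl.
  by rewrite sumrB -mulr_sumr w1 mulr1.
have rho0 : 0 <= cos (pi * d) ^+ (2 * n) by rewrite mulnC exprM sqr_ge0.
apply: (@le_trans _ _ (\sum_(j < n.+1) (e * w j + 2 * M * cos (pi * d) ^+ (2 * n)))).
  rewrite (le_trans (ler_norm_sum _ _ _)) //; apply: ler_sum => j _.
  have wj0 : 0 <= w j by exact: w0.
  rewrite normrM (ger0_norm wj0).
  have [near|far] := ltP `|j%:R / n.+1%:R - x| d.
    by rewrite (le_trans (ler_wpM2r wj0 (ge _ near))) // lerDl !mulr_ge0.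
  rewrite (@le_trans _ _ (2 * M * cos (pi * d) ^+ (2 * n))) ?lerDr ?(mulr_ge0 e0 wj0) //.
  apply: ler_pM => //.
    by rewrite (le_trans (ler_normB _ _)) // (_ : 2 * M = M + M) ?lerD //; ring.
  rewrite /w ler_pdivrMr // /cos_kernel exprMn mulrC.
  apply: ler_pM.
  - by rewrite mulnC exprM sqr_ge0.
  - by rewrite exprn_ge0.
  - have far2 : `|cos (pi * (x - j%:R / n.+1%:R))| <= cos (pi * d).
      apply: abs_cos_far => //; first by rewrite distrC.
      have j0 : 0 <= j%:R / n.+1%:R :> R by rewrite divr_ge0.
      have j1 : j%:R / n.+1%:R <= 1 :> R.
        by rewrite ler_pdivrMr ?ltr0n // mul1r ler_nat ltnW.
      by move: j0 j1; move: (_ / _) => y y0 y1; rewrite ler_norml; apply/andP; split; lra.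
    rewrite !exprM lerXn2r ?nnegrE ?sqr_ge0 // -[leLHS]real_normK ?num_real //.
    by rewrite lerXn2r ?nnegrE // (le_trans _ far2).
  - rewrite exprM (_ : 2 ^+ 2 = 4 :> R); last by ring.
    exact: central_bin_ge.
rewrite big_split /= -mulr_sumr w1 mulr1 sumr_const card_ord lerD2l.
by rewrite -[leLHS]mulr_natl mulrCA.
Qed.

(** Stated at interior points: the kernel has period 1 while [g] need not, so the limit may fail at
    0. *)
Lemma trig_sampling_cvg (g : R -> R) M x : (forall y, `|g y| <= M) ->
  {for x, continuous g} -> 0 < x -> x < 1 ->
  trig_sampling g n x @[n --> \oo] --> g x.
Proof.
move=> gM cg x0 x1; apply/cvgrPdist_le => e e0.
have M0 : 0 <= M by rewrite (le_trans _ (gM 0)).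
have e2 : 0 < e / 2 by rewrite divr_gt0.
have [d1 d10 gd] : exists2 d, 0 < d & forall y, `|y - x| < d -> `|g y - g x| <= e / 2.
  have /cvgrPdist_le/(_ _ e2)/nbhs_ballP [d d0 H] := cg.
  exists d => // y yx; rewrite distrC; apply: H.
  by rewrite /ball /= distrC.
pose d := Num.min d1 (Num.min x (1 - x)).
have d0 : 0 < d by rewrite !lt_min d10 x0 subr_gt0.
have dd1 : d <= d1 by rewrite ge_min lexx.
have dx : d <= x by rewrite !ge_min lexx orbT.
have dx1 : d <= 1 - x by rewrite !ge_min lexx !orbT.
have p0 := pi_gt0 R.
have dh : d <= 1 / 2 by move: (d) dx dx1 => d' h1 h2; lra.
have c0 : 0 <= cos (pi * d).
  apply: cos_ge0_pihalf; rewrite (le_trans _ (mulr_ge0 (ltW p0) (ltW d0))) //=.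
    by rewrite (_ : pi / 2 = pi * (1 / 2)) ?ler_pM2l // mul1r.
  by rewrite oppr_le0 divr_ge0 // ltW.
have c1 : cos (pi * d) < 1.
  rewrite -cos0 ltr_cos ?in_itv /= ?lexx ?(ltW p0) ?mulr_gt0 //.
  rewrite mulr_ge0 ?(ltW p0) ?(ltW d0) //= ger_pMr // (le_trans dh) //.
  by rewrite ler_pdivrMr // mul1r ler1n.
have M1 : 0 < 2 * M + 1 by rewrite ltr_wpDl // mulr_ge0.
have [k Hk] := pow_decay c0 c1 (divr_gt0 e2 M1).
exists k => // n /= kn; rewrite distrC.
have gd' y : `|y - x| < d -> `|g y - g x| <= e / 2.
  by move=> yx; apply: gd; exact: lt_le_trans dd1.
rewrite (le_trans (trig_sampling_dist n gM d0 dx dx1 gd' (ltW e2))) //.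
rewrite [leRHS](splitr e) lerD2l.
have := Hk n kn; rewrite ler_pdivlMr // => H; apply: le_trans H.
rewrite mulrC ler_wpM2l ?lerDl //.
by rewrite mulr_ge0 // exprn_ge0.
Qed.

End SamplingConvergence.

(** * Approximation in square norm *)

Section TrigDensity.
Context {R : realType}.
Local Open Scope complex_scope.
Local Notation mu := (@lebesgue_measure R).
Local Notation D := (`[0%R, 1%R[%classic : set R).

Let mD : measurable D. Proof. exact: measurable_itv. Qed.

Let muD : (mu D < +oo)%E. Proof. by rewrite mu_unit ltry. Qed.

Definition trig_approx (h : R -> R[i]) := forall e : R, 0 < e ->
  exists2 T, is_trig T & (L2norm2 D (fun x => (h x - T x)%R) <= e%:E)%E.

Lemma L2_trig T : is_trig T -> L2 D T.
Proof.
move=> [s ->]; apply: L2_sum => // p _; apply: L2Z => //; exact: L2_cexp2pi.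
Qed.

Lemma cmeasurable_trig T : is_trig T -> cmeasurable D T.
Proof. by move=> /L2_trig/L2_cmeasurable. Qed.

Lemma trig_approx_close h : cmeasurable D h ->
  (forall e : R, 0 < e -> exists g, [/\ cmeasurable D g, trig_approx g &
     (L2norm2 D (fun x => (h x - g x)%R) <= e%:E)%E]) -> trig_approx h.
Proof.
move=> mh H e e0; have e4 : 0 < e / 4 by rewrite divr_gt0.
have [g [mg /(_ _ e4)[T tT gT] hg]] := H _ e4.
exists T => //.
rewrite (_ : (fun x => _) = (fun x => (h x - g x) + (g x - T x))); last first.
  by apply/funext => x; rewrite addrA subrK.
have mT := cmeasurable_trig tT.
apply: (le_trans (L2norm2D_le mD (cmeasurableB mh mg) (cmeasurableB mg mT))).
have -> : e = 2 * (e / 4) + 2 * (e / 4) by field.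
by rewrite (EFinD (2 * _)) (EFinM 2); apply: leeD; rewrite lee_pmul2l // lte_fin.
Qed.

Lemma trig_approxD f g : cmeasurable D f -> cmeasurable D g ->
  trig_approx f -> trig_approx g -> trig_approx (fun x => f x + g x).
Proof.
move=> mf mg af ag e e0; have e4 : 0 < e / 4 by rewrite divr_gt0.
have [T tT fT] := af _ e4; have [S tS gS] := ag _ e4.
exists (fun x => T x + S x); first exact: is_trigD.
rewrite (_ : (fun x => _) = (fun x => (f x - T x) + (g x - S x))); last first.
  by apply/funext => x; rewrite opprD addrACA.
have mT := cmeasurable_trig tT; have mS := cmeasurable_trig tS.
apply: (le_trans (L2norm2D_le mD (cmeasurableB mf mT) (cmeasurableB mg mS))).
have -> : e = 2 * (e / 4) + 2 * (e / 4) by field.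
by rewrite (EFinD (2 * _)) (EFinM 2); apply: leeD; rewrite lee_pmul2l // lte_fin.
Qed.

Lemma trig_approxZ c f : cmeasurable D f -> trig_approx f ->
  trig_approx (fun x => c * f x).
Proof.
move=> mf af e e0; have c0 : 0 < cabs2 c + 1 by rewrite ltr_wpDl // cabs2_ge0.
have [T tT fT] := af _ (divr_gt0 e0 c0).
exists (fun x => c * T x); first exact: is_trigZ.
rewrite (_ : (fun x => _) = (fun x => c * (f x - T x))); last first.
  by apply/funext => x; rewrite mulrBr.
rewrite L2norm2_normZ //; last exact: cmeasurableB (cmeasurable_trig tT).
apply: (@le_trans _ _ ((cabs2 c)%:E * (e / (cabs2 c + 1))%:E)%E).
  by rewrite lee_wpmul2l // lee_fin cabs2_ge0.
rewrite -EFinM lee_fin mulrCA ger_pMr // ler_pdivrMr // mul1r lerDl //.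
Qed.

Lemma cmeasurable_real (u : R -> R) : measurable_fun D u ->
  cmeasurable D (fun x => (u x)%:C).
Proof. by move=> mu_; split => //=; exact: measurable_cst. Qed.

Lemma L2norm2_realB (u v : R -> R) :
  L2norm2 D (fun x => (u x)%:C - (v x)%:C) = (\int[mu]_(x in D) ((u x - v x) ^+ 2)%:E)%E.
Proof.
by apply: eq_integral => x _; rewrite -rmorphB /= cabs2_real.
Qed.

Lemma sqr_integral_cvg0 (u : R -> R) (v : nat -> R -> R) (k : R -> R) (e : R) :
  measurable_fun D u -> (forall n, measurable_fun D (v n)) ->
  mu.-integrable D (EFin \o k) ->
  (forall n x, D x -> (u x - v n x) ^+ 2 <= k x) ->
  (forall x, 0 < x -> x < 1 -> v n x @[n --> \oo] --> u x) ->
  0 < e -> exists n, (\int[mu]_(x in D) ((u x - v n x) ^+ 2)%:E <= e%:E)%E.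
Proof.
move=> mu_ mv ik vk cv e0.
pose f_ n x := ((u x - v n x) ^+ 2)%:E.
have mf n : measurable_fun D (f_ n).
  by apply/measurable_EFinP; apply: measurable_funX; exact: measurable_funB.
have ae0 : {ae mu, forall x, D x -> f_ ^~ x @ \oo --> 0%E}.
  (* Convergence is given on the open interval only; the remaining point 0 is a null set. *)
  exists [set 0]; split; [exact: measurable_set1|exact: lebesgue_measure_set1|].
  move=> x /= /not_implyP[]; rewrite in_itv /= => /andP[x0 x1] nc.
  apply/eqP; apply: contra_notT nc => xn0.
  have xp : 0 < x by rewrite lt_def xn0.
  apply/fine_cvgP; split; first by apply: nearW.
  have -> : fine \o (f_ ^~ x) = (fun n => (u x - v n x) * (u x - v n x)).
    by apply/funext => n /=; rewrite expr2.
  have cvB : u x - v n x @[n --> \oo] --> u x - u x.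
    by apply: cvgB; [exact: cvg_cst|exact: cv].
  by have := cvgM cvB cvB; rewrite subrr mulr0; apply.
have kb : {ae mu, forall x n, D x -> (`|f_ n x| <= (EFin \o k) x)%E}.
  by apply: aeW => x n Dx; rewrite /f_ /= lee_fin ger0_norm ?sqr_ge0 // vk.
have [_ _] := @dominated_convergence _ _ _ mu D mD f_ (cst 0%E) (EFin \o k) mf
  (measurable_cst _) ae0 ik kb.
rewrite integral0 => /fine_cvgP[[n1 _ fn] /cvgrPdist_le /(_ _ e0)[n2 _ H]].
exists (maxn n1 n2).
have := H (maxn n1 n2) (leq_maxr _ _); rewrite sub0r normrN /= => le_e.
change (\int[mu]_(x in D) f_ (maxn n1 n2) x <= e%:E)%E.
move: (fineK (fn (maxn n1 n2) (leq_maxl _ _))) => /= <-; rewrite lee_fin.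
exact: le_trans (ler_norm _) le_e.
Qed.

Definition clip (M y : R) : R := Num.max (- M) (Num.min y M).

Lemma clip_le M y : 0 <= M -> `|clip M y| <= M.
Proof.
move=> M0; rewrite /clip ler_norml le_max lexx /= ge_max.
by rewrite ge_min lexx orbT andbT (le_trans _ M0) // oppr_le0.
Qed.

Lemma clip_id M y : `|y| <= M -> clip M y = y.
Proof.
by rewrite ler_norml => /andP[h1 h2]; rewrite /clip (min_idPl h2) (max_idPr h1).
Qed.

Lemma clip_dist M y z : `|y| <= M -> `|y - clip M z| <= `|y - z|.
Proof.
rewrite ler_norml => /andP[h1 h2].
rewrite /clip; case: (leP z M) => zM; case: (leP (- M) z) => Mz //.
- have a1 : 0 <= y - - M by lra.
  have a2 : 0 <= y - z by lra.
  by rewrite (ger0_norm a1) (ger0_norm a2); lra.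
- have MM : - M <= M by lra.
  have a1 : y - M <= 0 by lra.
  have a2 : y - z <= 0 by lra.
  by rewrite max_r // (ler0_norm a1) (ler0_norm a2); lra.
- by have := lt_trans zM Mz; lra.
Qed.

Lemma clip_normB M y : 0 <= M -> `|y - clip M y| <= `|y|.
Proof.
move=> M0; rewrite /clip; case: (leP y M) => yM; case: (leP (- M) y) => My.
- by rewrite subrr normr0.
- have a1 : y <= 0 by lra.
  have a2 : y - - M <= 0 by lra.
  by rewrite (ler0_norm a1) (ler0_norm a2); lra.
- have a1 : 0 <= y by lra.
  have a2 : 0 <= y - M by lra.
  have MM : - M <= M by lra.
  by rewrite max_r // (ger0_norm a1) (ger0_norm a2); lra.
- by have := lt_trans yM My; lra.
Qed.

Lemma continuous_clip M (g : R -> R) : continuous g -> continuous (clip M \o g).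
Proof.
move=> cg x; rewrite /clip /comp.
apply: (@continuous_max R R (fun=> - M) (fun y => Num.min (g y) M) x).
  exact: cst_continuous.
apply: (@continuous_min R R g (fun=> M) x); first exact: cg.
exact: cst_continuous.
Qed.

Lemma trig_approx_bounded_cont (g : R -> R) M : continuous g ->
  (forall y, `|g y| <= M) -> trig_approx (fun x => (g x)%:C).
Proof.
move=> cg gM e e0.
have mg : measurable_fun D g by apply: measurable_funTS; exact: continuous_measurable_fun.
have mT n : measurable_fun D (trig_sampling g n).
  by have [+ _] := cmeasurable_trig (is_trig_sampling g n).
have ik : mu.-integrable D (EFin \o cst ((2 * M) ^+ 2)).
  apply: measurable_bounded_integrable => //.
  by exists ((2 * M) ^+ 2); split; rewrite ?num_real // => y yM x _ /=;
    rewrite ger0_norm ?sqr_ge0 // ltW.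
have M0 : 0 <= M by rewrite (le_trans _ (gM 0)).
have [] := @sqr_integral_cvg0 g (trig_sampling g) (cst ((2 * M) ^+ 2)) e mg mT ik _ _ e0.
- move=> n x _ /=; rewrite -real_normK ?num_real // ler_sqr ?nnegrE ?mulr_ge0 //.
  rewrite (le_trans (ler_normB _ _)) // (_ : 2 * M = M + M); last by ring.
  by rewrite lerD // trig_sampling_le.
- by move=> x x0 x1; apply: (@trig_sampling_cvg _ g M) => //; exact: cg.
move=> n Hn; exists (fun x => (trig_sampling g n x)%:C); first exact: is_trig_sampling.
by rewrite L2norm2_realB.
Qed.

(** Continuous functions approximate [u] in [L^1]. Clipping them at [M] keeps them continuous, does
    not increase the distance to [u], and bounds the error by [2 M], so the squared error is at most
    [2 M] times the [L^1] error. *)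
Lemma trig_approx_bounded (u : R -> R) M : measurable_fun D u -> 0 <= M ->
  (forall y, `|u y| <= M) -> trig_approx (fun x => (u x)%:C).
Proof.
move=> mu_ M0 uM; apply: trig_approx_close; first exact: cmeasurable_real.
move=> e e0; have M1 : 0 < 2 * M + 1 by rewrite ltr_wpDl // mulr_ge0.
have iu : mu.-integrable D (EFin \o u).
  apply: measurable_bounded_integrable => //.
  by exists M; split; rewrite ?num_real // => y yM x _ /=; rewrite (le_trans (uM x)) // ltW.
have [g_ [cg ig /fine_cvgP[[n1 _ fn] /cvgrPdist_le /(_ _ (divr_gt0 e0 M1))[n2 _ H]]]] :=
  approximation_continuous_integrable mD muD iu.
pose n := maxn n1 n2; pose g := clip M \o g_ n.
have cgc : continuous g by exact: continuous_clip.
have mg : measurable_fun D g by apply: measurable_funTS; exact: continuous_measurable_fun.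
exists (fun x => (g x)%:C); split; first exact: cmeasurable_real.
  by apply: (@trig_approx_bounded_cont g M) => // y; exact: clip_le.
rewrite L2norm2_realB.
have mgn : measurable_fun D (g_ n).
  by apply: measurable_funTS; exact: continuous_measurable_fun.
have mdiff : measurable_fun D (fun x => `|(u x - g_ n x)%:E|%E).
  apply: measurableT_comp => //; apply/measurable_EFinP; exact: measurable_funB.
apply: (@le_trans _ _ (\int[mu]_(x in D) ((2 * M)%:E * `|(u x - g_ n x)%:E|))%E).
  apply: ge0_le_integral => //.
  - by move=> x _; rewrite lee_fin sqr_ge0.
  - by apply/measurable_EFinP; apply: measurable_funX; exact: measurable_funB.
  - exact: measurable_funeM.
  - move=> x _; rewrite abse_EFin -EFinM lee_fin -real_normK ?num_real // expr2.
    apply: ler_pM => //; last exact: clip_dist.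
    rewrite (le_trans (ler_normB _ _)) // (_ : 2 * M = M + M); last by ring.
    by rewrite lerD // clip_le.
rewrite ge0_integralZl //; last by rewrite lee_fin mulr_ge0.
have := H n (leq_maxr _ _); rewrite sub0r normrN /= => le_e.
move: (fineK (fn n (leq_maxl _ _))) => /= <-; rewrite -EFinM lee_fin.
apply: (@le_trans _ _ (2 * M * (e / (2 * M + 1)))).
  by rewrite ler_wpM2l ?mulr_ge0 // (le_trans (ler_norm _) le_e).
by rewrite mulrCA ger_pMr // ler_pdivrMr // mul1r lerDl.
Qed.

(** Truncation: the clipped functions tend to [u] pointwise with squared error at most [u^2], which
    serves as the dominating function. *)
Lemma trig_approx_real (u : R -> R) : measurable_fun D u ->
  mu.-integrable D (fun x => (u x ^+ 2)%:E) -> trig_approx (fun x => (u x)%:C).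
Proof.
move=> mu_ iu2; apply: trig_approx_close; first exact: cmeasurable_real.
move=> e e0.
have mclip n : measurable_fun D (fun x => clip n%:R (u x)).
  apply: measurable_maxr; first exact: measurable_cst.
  by apply: measurable_minr => //; exact: measurable_cst.
have [] := @sqr_integral_cvg0 u (fun n x => clip n%:R (u x)) (fun x => u x ^+ 2) e
  mu_ mclip iu2 _ _ e0.
- move=> n x _; rewrite -[leLHS]real_normK ?num_real // -[leRHS]real_normK ?num_real //.
  by rewrite ler_sqr ?nnegrE // clip_normB.
- move=> x _ _; apply: cvg_near_cst.
  exists (Num.truncn `|u x|).+1 => // n /= un; apply: clip_id.
  rewrite (le_trans (ltW (truncnS_gt _))) // ler_nat //.
move=> n Hn; exists (fun x => (clip n%:R (u x))%:C); split.
- exact: cmeasurable_real.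
- by apply: (@trig_approx_bounded _ n%:R) => // y; exact: clip_le.
- by rewrite L2norm2_realB.
Qed.

Lemma L2_trig_approx h : L2 D h -> trig_approx h.
Proof.
move=> /L2P[mh ih]; have [h1 h2] := mh.
have i1 : mu.-integrable D (fun x => (complex.Re (h x) ^+ 2)%:E).
  apply: (@le_integrable _ _ _ mu D mD _ (fun x => (cabs2 (h x))%:E)) => //.
  - by apply/measurable_EFinP; exact: measurable_funX.
  - move=> x _; rewrite /= lee_fin !ger0_norm ?sqr_ge0 ?cabs2_ge0 //.
    by rewrite /cabs2 lerDl sqr_ge0.
have i2 : mu.-integrable D (fun x => (complex.Im (h x) ^+ 2)%:E).
  apply: (@le_integrable _ _ _ mu D mD _ (fun x => (cabs2 (h x))%:E)) => //.
  - by apply/measurable_EFinP; exact: measurable_funX.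
  - move=> x _; rewrite /= lee_fin !ger0_norm ?sqr_ge0 ?cabs2_ge0 //.
    by rewrite /cabs2 lerDr sqr_ge0.
rewrite (_ : h = (fun x => (complex.Re (h x))%:C
    + (0 +i* 1) * (complex.Im (h x))%:C)); last first.
  by apply/funext => x; rewrite [LHS]complexE.
apply: trig_approxD.
- exact: cmeasurable_real.
- apply: cmeasurableM; [exact: cmeasurable_cst|exact: cmeasurable_real].
- exact: trig_approx_real.
- by apply: trig_approxZ; [exact: cmeasurable_real|exact: trig_approx_real].
Qed.

(** A list may repeat a frequency, whereas Bessel's identity asks for distinct ones. *)
Lemma trig_collect (s : seq (R[i] * int)) (J : seq int) : uniq J ->
  {subset [seq p.2 | p <- s] <= J} ->
  trig s = (fun x => \sum_(k <- J) (\sum_(p <- s | p.2 == k) p.1) * cexp2pi k%:~R x).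
Proof.
move=> uJ sJ; apply/funext => x; rewrite /trig.
under [RHS]eq_bigr do rewrite mulr_suml.
rewrite (exchange_big_dep predT) //= big_seq [RHS]big_seq.
apply: eq_bigr => p ps.
rewrite big_mkcond (bigD1_seq p.2) //=; last by apply: sJ; apply/mapP; exists p.
by rewrite eqxx big1 ?addr0 // => k; rewrite eq_sym => /negbTE ->.
Qed.

(** Bessel's inequality controls the finite partial sums. Conversely, if a trigonometric polynomial
    is within [e] of [h] in squared norm, [bessel_approx] shows that its finitely many frequencies
    capture all but [e]. *)
Theorem parseval h : L2 D h ->
  (\esum_(n in [set: int]) (cabs2 (L2dot D h (cexp2pi n%:~R)))%:E)%E = L2norm2 D h.
Proof.
move=> lh; apply/eqP; rewrite eq_le; apply/andP; split.
- apply: ub_ereal_sup => _ [X [fX _] <-].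
  rewrite fsbig_finite //= sumEFin; have [-> _] := L2dot_self mD lh.
  rewrite lee_fin; apply: bessel_ineq => //; first exact: fset_uniq.
  + by move=> i _; exact: L2_cexp2pi.
  + by move=> i j _ _; exact: cexp2pi_orthonormal.
- apply/lee_addgt0Pr => e e0.
  have [T [s ->] hT] := L2_trig_approx lh e0.
  pose J := undup [seq p.2 | p <- s].
  have TE := @trig_collect s J (undup_uniq _) (fun k => etrans (mem_undup _ k)).
  move: hT; rewrite TE => hT.
  have := @bessel_approx _ D mD _ (fun n : int => cexp2pi n%:~R) J (undup_uniq _)
    (fun i _ => L2_cexp2pi _) (fun i j _ _ => cexp2pi_orthonormal i j) h
    (fun k => \sum_(p <- s | p.2 == k) p.1) lh.
  move=> /le_trans; apply; apply: leeD => //.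
  apply: esum_ge; exists [set` J]; first by split=> //; exact: finite_seq.
  by rewrite -sumEFin (fsbig_seq _ _ (undup_uniq _)).
Qed.

End TrigDensity.

(** * The upper bound for the sampling matrix *)

Section SampledExponentials.
Context {R : realType}.
Local Open Scope complex_scope.
Local Notation mu := (@lebesgue_measure R).
Local Notation D := (`[0%R, 1%R[%classic : set R).

(** Concavity: the mean slope of the sine over [[0, y]] is at least that over [[y, pi / 2]], by
    comparing the cosines at two mean value points. *)
Lemma jordan_sin (y : R) : 0 <= y <= pi / 2 -> 2 / pi * y <= sin y.
Proof.
move=> /andP[y0 ypi]; have p0 := pi_gt0 R.
have mvt (u v : R) : u <= v -> exists2 c, u <= c <= v & sin v - sin u = cos c * (v - u).
  move=> uv.
  have [c +] : exists2 c, c \in `[u, v]%R & sin v - sin u = cos c * (v - u).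
    by apply: MVT_segment => //; apply: continuous_subspaceT; exact: continuous_sin.
  by rewrite in_itv /= => cuv e; exists c.
have [c1 /andP[c10 c1y]] := mvt 0 y y0; rewrite sin0 !subr0 => s1.
have [c2 /andP[yc2 c2p]] := mvt y (pi / 2) ypi; rewrite sin_pihalf => s2.
have c21 : cos c2 <= cos c1.
  apply: ler_cos => //; first exact: le_trans yc2.
  by rewrite (le_trans c2p) // ler_pdivrMr // ler_peMr ?(ltW p0) // ler1n.
have H : y * (1 - sin y) <= sin y * (pi / 2 - y).
  rewrite s2 s1 mulrCA -[leRHS]mulrA.
  by rewrite ler_wpM2r // mulr_ge0 // subr_ge0.
have H2 : y <= sin y * (pi / 2).
  by move: H; rewrite mulrBr mulr1 mulrBr (mulrC y) lerD2r.
by rewrite mulrC mulrA ler_pdivrMr // -ler_pdivlMr // -mulrA.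
Qed.

Lemma cexp2pi_shift_orthonormal (s : R) (m n : nat) :
  L2dot D (cexp2pi (m%:R - s)) (cexp2pi (n%:R - s)) = (m == n)%:R :> R[i].
Proof.
have -> : (m == n) = (m%:Z == n%:Z) by [].
rewrite -cexp2pi_orthonormal; apply: L2dot_mulE => x _.
rewrite !cexp2piE -!cisN -!cisD; congr cis; rewrite -!pmulrn; ring.
Qed.

Lemma L2dot_indic (c : R) (g : R -> R[i]) (I : set R) : I `<=` D ->
  L2dot D (fun x => (c * \1_I x)%:C) g = L2dot I (fun=> c%:C) g.
Proof.
move=> ID.
have DI : D `&` I = I by apply/seteqP; split=> [x []|x Ix]//; split=> //; exact: ID.
have H (p : R[i] -> R) : p 0 = 0 ->
    (\int[mu]_(x in D) p ((c * \1_I x)%:C * (g x)^*%C) =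
     \int[mu]_(x in I) p (c%:C * (g x)^*%C))%R.
  move=> p0; rewrite -{2}DI Rintegral_mkcondr; apply: eq_Rintegral => x _.
  by rewrite patchE indicE; case: ifP => _; rewrite ?mulr1 // mulr0 mul0r p0.
by rewrite /L2dot /= (H (@complex.Re R)) // (H (@complex.Im R)).
Qed.

Variables (a : R) (L : nat).
Hypotheses (a0 : 0 < a) (aL : a * L%:R <= 1).

Let cell (j : nat) : set R := `[j%:R * a, (j%:R + 1) * a[%classic.

Let mcell j : measurable (cell j). Proof. exact: measurable_itv. Qed.

Let cell_sub (j : 'I_L) : cell j `<=` D.
Proof.
move=> x; rewrite /cell /= !in_itv /= => /andP[h1 h2].
rewrite (le_trans _ h1) ?mulr_ge0 ?(ltW a0) //= (lt_le_trans h2) //.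
by rewrite (le_trans _ aL) // mulrC ler_wpM2l ?(ltW a0) // natr1 ler_nat.
Qed.

Let cell_lt (j : nat) : j%:R * a < (j%:R + 1) * a.
Proof. by rewrite ltr_pM2r // ltrDl. Qed.

Let Rint_cell (j : nat) (r : R) : (\int[mu]_(x in cell j) r = r * a)%R.
Proof.
transitivity (r * fine (mu (cell j))).
  exact: (@Rintegral_cst _ _ R mu (cell j) (mcell j) r).
have e : @lebesgue_measure R (cell j) = a%:E.
  rewrite lebesgue_measure_itv /= lte_fin cell_lt -EFinB.
  by congr (_%:E); ring.
by congr (_ * _); exact: (congr1 fine e).
Qed.

(** Normalised indicators of disjoint cells, which fit into the unit interval because
    [a * L <= 1]. *)
Let b (j : 'I_L) (x : R) : R[i] := ((Num.sqrt a)^-1 * \1_(cell j) x)%:C.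

Let L2_b j : L2 D (b j).
Proof.
apply: (@L2_bounded _ _ _ _ ((Num.sqrt a)^-1 ^+ 2)) => //.
- split; rewrite /b /=; last exact: measurable_cst.
  by apply: measurable_funM; [exact: measurable_cst|exact: measurable_indic].
- by rewrite mu_unit ltry.
- move=> x _; rewrite /b cabs2_real indicE exprMn.
  by case: (_ \in _); rewrite ?expr1n ?expr0n ?mulr1 // mulr0 sqr_ge0.
Qed.

Let b_orth i j : L2dot D (b i) (b j) = (i == j)%:R.
Proof.
rewrite L2dot_indic; last exact: cell_sub.
have [<-|ij] := eqVneq i j.
  rewrite (@L2dot_mulE _ _ _ _ (fun=> (a^-1)%:C)); last first.
    move=> x ix; rewrite /b indicE mem_set // mulr1 conjc_real -rmorphM /=.
    by congr (_%:C); rewrite -invfM -expr2 sqr_sqrtr // ltW.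
  by rewrite /= !Rint_cell mul0r mulVf // gt_eqF.
rewrite (@L2dot_mulE _ _ _ _ (fun=> 0)); first by rewrite /= !Rint_cell mul0r.
move=> x ix; rewrite /b indicE (_ : x \in cell j = false) ?mulr0 ?conjc0 ?mulr0 //.
apply/negP; rewrite inE; move: ix; rewrite /cell /= !in_itv /=.
move=> /andP[i1 i2] /andP[j1 j2].
have h1 : i%:R * a < (j%:R + 1) * a by exact: le_lt_trans j2.
have h2 : j%:R * a < (i%:R + 1) * a by exact: le_lt_trans i2.
move: h1 h2; rewrite !ltr_pM2r // !natr1 !ltr_nat !ltnS => h1 h2.
by move: ij; rewrite -val_eqE /= eqn_leq h1 h2.
Qed.

(** Centring the frequencies at [L / 2] keeps [|w p * a / 2|] at most [pi / 2], the range of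
    [jordan_sin]. *)
Let w (p : nat) : R := 2 * pi * (p%:R - L%:R / 2).

(** Integral of the exponential of frequency [w p] over one cell, without its phase; [a] is the
    limit as [w p] tends to 0. *)
Let S (p : nat) : R := if w p == 0 then a else 2 * sin (w p * a / 2) / w p.

Let b_exp (j : 'I_L) (p : nat) :
  L2dot D (b j) (cexp2pi (p%:R - L%:R / 2))
  = ((Num.sqrt a)^-1 * S p)%:C * cis (- (w p * (j%:R * a + a / 2))).
Proof.
rewrite L2dot_indic; last exact: cell_sub.
set s := (Num.sqrt a)^-1; have ab := cell_lt j.
rewrite (@L2dot_mulE _ _ _ _ (fun x => s%:C * cis (- w p * x))); last first.
  by move=> x _; rewrite cexp2piE -cisN mulNr.
rewrite /S; case: (eqVneq (w p) 0) => [->|w0].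
  under eq_Rintegral do rewrite oppr0 mul0r cis0 mulr1.
  under [X in Complex _ X]eq_Rintegral do rewrite oppr0 mul0r cis0 mulr1.
  by rewrite /= !Rint_cell !mul0r oppr0 cis0 mulr1.
have nw0 : - w p != 0 by rewrite oppr_eq0.
have cI : mu.-integrable (cell j) (EFin \o (fun x => cos (- w p * x))).
  by apply: continuous_integrable_itv; exact: continuous_cosZ.
have sI : mu.-integrable (cell j) (EFin \o (fun x => sin (- w p * x))).
  by apply: continuous_integrable_itv; exact: continuous_sinZ.
under eq_Rintegral do rewrite /= mul0r subr0.
under [X in Complex _ X]eq_Rintegral do rewrite /= mul0r addr0.
rewrite (@RintegralZl _ _ R mu (cell j) _ s (mcell j) cI).
rewrite (@RintegralZl _ _ R mu (cell j) _ s (mcell j) sI) /cell.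
rewrite Rintegral_cos // Rintegral_sin //.
set phi := - (w p * (j%:R * a + a / 2)); set h := w p * a / 2.
have -> : - w p * ((j%:R + 1) * a) = phi - h by rewrite /phi /h; field.
have -> : - w p * (j%:R * a) = phi + h by rewrite /phi /h; field.
clearbody phi h; clear S; move: (w p) w0 {nw0 cI sI} => w' w0'.
rewrite !cosD !sinD !cosN !sinN.
by apply/eqP; rewrite eq_complex /=; apply/andP; split; apply/eqP; field.
Qed.

Let S_sqr_ge (p : nat) : (p <= L)%N -> (2 * a / pi) ^+ 2 <= S p ^+ 2.
Proof.
move=> pL; have p0 := pi_gt0 R.
rewrite /S; case: eqVneq => [_|w0].
  rewrite ler_sqr ?nnegrE ?divr_ge0 ?mulr_ge0 ?(ltW a0) ?(ltW p0) //.
  by rewrite ler_pdivrMr // mulrC ler_wpM2l ?(ltW a0) // pi_ge2.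
set y := w p * a / 2.
have ypi : `|y| <= pi / 2.
  have -> : y = pi * (a * (p%:R - L%:R / 2)).
    by rewrite /y /w; move: (pi : R) => u; field.
  rewrite normrM (gtr0_norm p0) ler_pM2l // normrM (gtr0_norm a0).
  apply: (@le_trans _ _ (a * (L%:R / 2))).
    rewrite ler_wpM2l ?(ltW a0) //.
    have : p%:R <= L%:R :> R by rewrite ler_nat.
    have := ler0n R p; move: (p%:R) (L%:R) => u v u0 uv.
    by rewrite ler_norml; apply/andP; split; lra.
  by rewrite mulrA ler_piMl // invr_ge0.
have sy : (2 / pi) ^+ 2 * y ^+ 2 <= sin y ^+ 2.
  have := jordan_sin (y := `|y|); rewrite normr_ge0 ypi => /(_ isT) H.
  have -> : sin y ^+ 2 = sin `|y| ^+ 2.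
    have [h|h] := leP 0 y; first by rewrite ger0_norm.
    by rewrite ltr0_norm // sinN sqrrN.
  rewrite -exprMn -[leLHS]real_normK ?num_real // normrM.
  rewrite (@ger0_norm _ (2 / pi)) ?divr_ge0 ?(ltW p0) //.
  have m0 : 0 <= 2 / pi * `|y| by rewrite mulr_ge0 // divr_ge0 // ltW.
  by rewrite ler_sqr ?nnegrE // (le_trans m0 H).
have w2 : 0 < w p ^+ 2 by rewrite lt_def sqrf_eq0 w0 sqr_ge0.
rewrite [leRHS]expr_div_n ler_pdivlMr // [leRHS]exprMn.
have -> : (2 * a / pi) ^+ 2 * w p ^+ 2 = 4 * ((2 / pi) ^+ 2 * y ^+ 2).
  by rewrite /y; move: (pi : R) (lt0r_neq0 p0) => u un; field.
by rewrite (_ : 2 ^+ 2 = 4) ?ler_pM2l //; ring.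
Qed.

(** The coefficients of the step function [V] at the frequencies [p - L / 2] are, up to phases, the
    sums on the left times [S p / sqrt a]. As [S p ^ 2 >= (2 a / pi)^2], Bessel's inequality gives
    the factor [a (pi / (2 a))^2]. *)
Lemma sampled_upper (c : 'I_L -> R[i]) :
  \sum_(p < L.+1) cabs2 (\sum_(j < L) (cis (2 * (pi * a) * p%:R * j%:R))^*%C * c j)
  <= pi ^+ 2 / 4 / a * \sum_j cabs2 (c j).
Proof.
have p0 := pi_gt0 R.
(* The phase undoes the shift of the frequencies by [L / 2]. *)
pose u (j : 'I_L) := cis (- (pi * a * L%:R * j%:R)) * c j.
pose V x := \sum_(j <- index_enum 'I_L) u j * b j x.
have lV : L2 D V by apply: L2_sum => // j _; apply: L2Z.
have nV : complex.Re (L2dot D V V) = \sum_j cabs2 (c j).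
  have [e1 _] := L2dot_self (measurable_itv _) lV.
  have := L2norm2_orthonormal (measurable_itv _) (index_enum_uniq _) (fun j _ => L2_b j)
    (fun i j _ _ => b_orth i j) u.
  rewrite -/V e1 => -e2; rewrite (EFin_inj e2); apply: eq_bigr => j _.
  by rewrite cabs2M cabs2_cis mul1r.
pose e (p : nat) := cexp2pi (p%:R - L%:R / 2) : R -> R[i].
have := @bessel_ineq _ D (measurable_itv _) _ e (iota 0 L.+1) (iota_uniq _ _)
  (fun p _ => L2_cexp2pi _) (fun i j _ _ => cexp2pi_shift_orthonormal _ i j) V lV.
rewrite nV -/(index_iota 0 L.+1) big_mkord => H.
have k0 : 0 < pi ^+ 2 / 4 / a by rewrite !divr_gt0 // exprn_gt0.
apply: le_trans (ler_wpM2l (ltW k0) H); rewrite mulr_sumr; apply: ler_sum => p _.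
have pL : (p <= L)%N by rewrite -ltnS.
have -> : L2dot D V (e p) = ((Num.sqrt a)^-1 * S p)%:C * cis (- (w p * (a / 2))) *
    \sum_(j < L) (cis (2 * (pi * a) * p%:R * j%:R))^*%C * c j.
  rewrite L2dot_sum //; last 2 first.
  - by move=> j _; apply: L2Z.
  - exact: L2_cexp2pi.
  rewrite mulr_sumr; apply: eq_bigr => j _.
  rewrite L2dotZl //; last exact: L2_cexp2pi.
  rewrite b_exp /u mulrCA -!mulrA; congr (_ * _); rewrite (mulrC (c j)) -cisN !mulrA -!cisD.
  by congr (cis _ * _); rewrite /w; field.
rewrite cabs2M cabs2M cabs2_real cabs2_cis mulr1 [leRHS]mulrA.
apply: ler_peMl; first exact: cabs2_ge0.
have sa2 : Num.sqrt a ^+ 2 = a by rewrite sqr_sqrtr // ltW.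
rewrite exprMn exprVn sa2.
have : pi ^+ 2 / 4 / a * (a^-1 * (2 * a / pi) ^+ 2) <= pi ^+ 2 / 4 / a * (a^-1 * S p ^+ 2).
  by rewrite ler_wpM2l ?(ltW k0) // ler_wpM2l ?invr_ge0 ?(ltW a0) // S_sqr_ge.
apply: le_trans; rewrite le_eqVlt; apply/orP; left; apply/eqP.
by move: (pi : R) (lt0r_neq0 p0) => q qn; field; rewrite qn gt_eqF.
Qed.

End SampledExponentials.

(** * Singular values of the sampling matrix *)

Section Constants.
Context {R : realType}.
Implicit Types l : R.

(** Two doublings starting from [sin (2/5) >= 48/125] give [cos (4/5) < 1 / sqrt 2] and then
    [cos (8/5) < 0], so [pi / 2] cannot exceed [8/5]. *)
Lemma pi_le_16_5 : pi <= 16 / 5 :> R.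
Proof.
have p1 : 2 <= pi :> R := pi_ge2 R.
have s : 48 / 125 <= sin (2 / 5) :> R.
  apply: (@le_trans _ _ (2 / 5 - (2 / 5) ^+ 3 / 4)); first by lra.
  by apply: sin_ge_cubic; apply/andP; split; [lra | apply: le_trans p1; lra].
have c0 x : cos (2 * x) = 1 - 2 * sin x ^+ 2 :> R.
  rewrite mulr_natl cos_mulr2n cos2sin2; move: (sin x) => y; rewrite -mulr_natl; ring.
have c1 x : cos (2 * x) = 2 * cos x ^+ 2 - 1 :> R.
  by rewrite mulr_natl cos_mulr2n -mulr_natl.
have c2 : cos (4 / 5) <= 11017 / 15625 :> R.
  rewrite (_ : 4 / 5 = 2 * (2 / 5)) ?c0; last by field.
  by move: (sin _) s => y s; nra.
have c3 : 0 <= cos (4 / 5) :> R.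
  apply: cos_ge0_pihalf; move: (pi : R) p1 => q p1; apply/andP; split; lra.
have c4 : cos (8 / 5) < 0 :> R.
  rewrite (_ : 8 / 5 = 2 * (4 / 5)) ?c1; last by field.
  by move: (cos _) c2 c3 => y c2 c3; nra.
rewrite leNgt; apply/negP => h.
have : 0 < cos (8 / 5) :> R.
  by apply: cos_gt0_pihalf; move: (pi : R) p1 h => q p1 h; apply/andP; split; lra.
by rewrite ltNge ltW.
Qed.

Lemma mul_sin_inv_ge l : 1 <= l -> 1 - 1 / (4 * l ^+ 2) <= l * sin (1 / l).
Proof.
move=> l1; have l0 : 0 < l by rewrite (lt_le_trans ltr01).
have := sin_ge_cubic (x := 1 / l).
have -> : 0 <= 1 / l <= pi.
  rewrite divr_ge0 ?(ltW l0) //= (@le_trans _ _ 1) ?ler_pdivrMr ?mul1r //.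
  by rewrite (le_trans _ (pi_ge2 R)) // ler1n.
move=> /(_ isT) /(ler_wpM2l (ltW l0)); apply: le_trans.
by rewrite le_eqVlt; apply/orP; left; apply/eqP; field; rewrite gt_eqF.
Qed.

Lemma mul_sin_inv_le l : 1 <= l -> l * sin (1 / l) <= 1.
Proof.
move=> l1; have l0 : 0 < l by rewrite (lt_le_trans ltr01).
have h0 : 0 <= 1 / l by rewrite divr_ge0 // ltW.
by have := ler_wpM2l (ltW l0) (sin_le_id h0); rewrite mulrCA divff ?mulr1 // gt_eqF.
Qed.

Lemma inv_sin_ge l : 1 <= l -> 2 * l / pi <= 1 / sin (pi / (2 * l)).
Proof.
move=> l1; have l0 : 0 < l by rewrite (lt_le_trans ltr01).
have p0 := pi_gt0 R.
have x0 : 0 < pi / (2 * l) by rewrite divr_gt0 // mulr_gt0.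
have s0 : 0 < sin (pi / (2 * l)).
  apply: sin_gt0_pi; rewrite x0 ltr_pdivrMr ?mulr_gt0 //= ltr_pMr //.
  by lra.
rewrite ler_pdivlMr // mulrC; have := sin_le_id (ltW x0).
rewrite -(ler_pM2r (x := 2 * l / pi)) ?divr_gt0 ?mulr_gt0 // => /le_trans; apply.
rewrite le_eqVlt; apply/orP; left; apply/eqP.
by move: (pi : R) (lt0r_neq0 p0) => q qn; field; rewrite qn gt_eqF.
Qed.

(** When the second factor is positive, the factors are at most [1 / (4 l^2)] and [l - 2 l / pi];
    what remains is [(pi - 4)^2 >= 0]. *)
Lemma lower_constant_le l : 1 <= l ->
  (1 - l * sin (1 / l)) * (l - 1 / sin (pi / (2 * l))) <= pi / (32 * l).
Proof.
move=> l1; have l0 : 0 < l by rewrite (lt_le_trans ltr01).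
have p0 := pi_gt0 R.
have u1 := mul_sin_inv_ge l1; have u2 := mul_sin_inv_le l1; have v1 := inv_sin_ge l1.
set u := l * sin (1 / l) in u1 u2 *; set v := 1 / sin _ in v1 *.
have k0 : 0 < pi / (32 * l) by rewrite divr_gt0 // mulr_gt0.
have [vl|vl] := leP (l - v) 0.
  by rewrite (le_trans _ (ltW k0)) // mulr_ge0_le0 // subr_ge0.
apply: (@le_trans _ _ (1 / (4 * l ^+ 2) * (l - 2 * l / pi))).
  by apply: ler_pM; rewrite ?subr_ge0 ?(ltW vl) ?lerD2l ?lerN2 //; lra.
rewrite -subr_ge0.
have -> : pi / (32 * l) - 1 / (4 * l ^+ 2) * (l - 2 * l / pi)
   = (pi - 4) ^+ 2 / (32 * l * pi).
  by move: (pi : R) (lt0r_neq0 p0) => q qn; field; rewrite qn gt_eqF.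
by rewrite divr_ge0 ?sqr_ge0 // ltW // !mulr_gt0.
Qed.

(** The coefficient is [13/8 = 1 + 5/8], where [5/8 <= 2 / pi] comes from [pi_le_16_5]. *)
Lemma upper_constant_ge l : 1 <= l ->
  13 / 8 * (2 - 1 / (4 * l ^+ 2)) * l
  <= (1 + l * sin (1 / l)) * (l + 1 / sin (pi / (2 * l))).
Proof.
move=> l1; have l0 : 0 < l by rewrite (lt_le_trans ltr01).
have p0 := pi_gt0 R.
have u1 := mul_sin_inv_ge l1; have v1 := inv_sin_ge l1.
have v2 : 5 / 8 * l <= 2 * l / pi.
  rewrite ler_pdivlMr //.
  have := ler_wpM2l (ltW l0) pi_le_16_5; move: (pi : R) => q.
  by move=> h; rewrite (_ : 5 / 8 * l * q = 5 / 8 * (l * q)); [lra | ring].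
have l2 : 1 / (4 * l ^+ 2) <= 1.
  rewrite ler_pdivrMr ?mulr_gt0 ?exprn_gt0 // mul1r.
  by have := exprn_ege1 2 l1; lra.
rewrite (_ : 13 / 8 * _ * l = (2 - 1 / (4 * l ^+ 2)) * (13 / 8 * l)); last by ring.
by apply: ler_pM; lra.
Qed.

End Constants.

(** * Two-sided bounds for the sampling matrix and its adjoint *)

Section MatrixBounds.
Context {R : realType}.
Local Open Scope complex_scope.

(** With [v] the adjoint applied to [w], [S = |v|^2] is the pairing of [w] with [K v], and
    Cauchy-Schwarz gives [S^2 <= B |w|^2 S]. *)
Lemma dual_upper (n : nat) (K : 'I_n -> 'I_n -> R[i]) (B : R) :
  (forall c : 'I_n -> R[i],
    \sum_i cabs2 (\sum_j K i j * c j) <= B * \sum_j cabs2 (c j)) ->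
  forall w : 'I_n -> R[i],
    \sum_j cabs2 (\sum_i (K i j)^*%C * w i) <= B * \sum_i cabs2 (w i).
Proof.
move=> HK w; pose v j := \sum_i (K i j)^*%C * w i.
pose u i := \sum_j K i j * v j.
set S := \sum_j cabs2 (v j).
have S0 : 0 <= S by apply: sumr_ge0 => j _; exact: cabs2_ge0.
have SE : S%:C = \sum_i w i * (u i)^*%C.
  rewrite rmorph_sum /=.
  transitivity (\sum_j \sum_i (K i j)^*%C * w i * (v j)^*%C).
    apply: eq_bigr => j _; rewrite cabs2E sqr_normc {1}/v mulr_suml //.
  rewrite exchange_big; apply: eq_bigr => i _ /=.
  rewrite rmorph_sum mulr_sumr; apply: eq_bigr => j _.
  by rewrite rmorphM /= mulrA (mulrC (w i)).
have S2 : S * S <= (B * \sum_i cabs2 (w i)) * S.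
  rewrite -expr2 -cabs2_real SE (le_trans (cabs2_sum_le _ _)) //.
  rewrite (mulrC B) -mulrA ler_wpM2l //.
    by apply: sumr_ge0 => i _; exact: cabs2_ge0.
  by under eq_bigr do rewrite cabs2_conj; exact: HK.
have [Sp|] := ltP 0 S; first by rewrite ler_pM2r in S2.
move=> Sle; have -> : S = 0 by apply/eqP; rewrite eq_le Sle.
(* For [S = 0] the right side must be nonnegative; [HK] itself shows this, as [B] carries no
   sign. *)
have := HK (fun i => (w i)^*%C).
under [in leRHS]eq_bigr do rewrite cabs2_conj.
by apply: le_trans; apply: sumr_ge0 => i _; exact: cabs2_ge0.
Qed.

Variables (a : R) (L : nat).
Hypotheses (L_ge2 : (2 <= L)%N) (a0 : 1 / L.+1%:R <= a).
Hypothesis a1 : a <= 1 / L%:R - 1 / (2 * L%:R ^+ 2).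

Let Lp : 0 < L%:R :> R. Proof. by rewrite ltr0n; lia. Qed.

Let ap : 0 < a. Proof. by rewrite (lt_le_trans _ a0) // divr_gt0. Qed.

Let aL : a * L%:R < 1.
Proof.
rewrite -ltr_pdivlMr // (le_lt_trans a1) // gtrDl oppr_lt0 divr_gt0 //.
by rewrite mulr_gt0 // exprn_gt0.
Qed.

Let tau0 : 0 < pi * a. Proof. by rewrite mulr_gt0 ?pi_gt0. Qed.

Let tauL : pi * a * L%:R < pi.
Proof. by rewrite -mulrA gtr_pMr ?pi_gt0. Qed.

Let tauL1 : pi <= pi * a * L.+1%:R.
Proof. by rewrite -mulrA ler_pMr ?pi_gt0 // -ler_pdivrMr. Qed.

(** The bound [1/L - 1/(2 L^2)] lies below the midpoint of [1/L] and [1/(L + 1)], by exactly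
    [1 / (2 L^2 (L + 1))]. *)
Let taut0 : pi * a <= (pi / L%:R + pi / L.+1%:R) / 2.
Proof.
have -> : ((pi : R) / L%:R + pi / L.+1%:R) / 2 = pi * ((1 / L%:R + 1 / L.+1%:R) / 2).
  by rewrite !mul1r mulrA mulrDr.
rewrite ler_pM2l ?pi_gt0 // (le_trans a1) // -subr_ge0 -natr1.
have -> : (1 / L%:R + 1 / (L%:R + 1)) / 2 - (1 / L%:R - 1 / (2 * L%:R ^+ 2))
   = 1 / (2 * L%:R ^+ 2 * (L%:R + 1)) :> R.
  by field; rewrite natr1 !gt_eqF.
by rewrite divr_ge0 // !mulr_ge0 ?sqr_ge0 // addr_ge0.
Qed.

Variable m : 'I_L.+1.

Definition vdm (p j : 'I_L) : R[i] := cis (2 * (pi * a) * (lift m p)%:R * j%:R).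

Lemma vdm_lower (c : 'I_L -> R[i]) :
  pi / (32 * L%:R) * \sum_j cabs2 (c j) <= \sum_p cabs2 (\sum_j vdm p j * c j).
Proof.
have k0 : 0 < pi / (32 * L%:R) :> R by rewrite divr_gt0 ?pi_gt0 ?mulr_gt0.
have L0 : (0 < L)%N by lia.
have := ler_wpM2l (ltW k0) (rows_mx_lower tau0 L0 tauL tauL1 taut0 m c).
move=> /le_trans; apply; rewrite [leLHS]mulrA; apply: ler_piMl.
  by apply: sumr_ge0 => i _; exact: cabs2_ge0.
have p0 := lt0r_neq0 (pi_gt0 R).
rewrite le_eqVlt; apply/orP; left; apply/eqP.
by move: (pi : R) p0 => q qn; field; rewrite qn gt_eqF.
Qed.

Lemma vdm_dual_lower (w : 'I_L -> R[i]) :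
  pi / (32 * L%:R) * \sum_p cabs2 (w p)
  <= \sum_j cabs2 (\sum_p (vdm p j)^*%C * w p).
Proof.
have k0 : 0 < pi / (32 * L%:R) :> R by rewrite divr_gt0 ?pi_gt0 ?mulr_gt0.
have L0 : (0 < L)%N by lia.
have := ler_wpM2l (ltW k0) (rows_mx_dual_lower tau0 L0 tauL tauL1 taut0 m w).
move=> /le_trans; apply; rewrite [leLHS]mulrA; apply: ler_piMl.
  by apply: sumr_ge0 => i _; exact: cabs2_ge0.
have p0 := lt0r_neq0 (pi_gt0 R).
rewrite le_eqVlt; apply/orP; left; apply/eqP.
by move: (pi : R) p0 => q qn; field; rewrite qn gt_eqF.
Qed.

Let B : R := (1 + L%:R * sin (1 / L%:R)) * (L%:R + 1 / sin (pi / (2 * L%:R))).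

Let S0 (c : 'I_L -> R[i]) : 0 <= \sum_j cabs2 (c j).
Proof. by apply: sumr_ge0 => i _; exact: cabs2_ge0. Qed.

(* For [L <= 3] the Frobenius norm suffices. *)
Lemma vdm_upper (c : 'I_L -> R[i]) :
  \sum_p cabs2 (\sum_j vdm p j * c j) <= B * \sum_j cabs2 (c j).
Proof.
have L1 : 1 <= L%:R :> R by rewrite ler1n; lia.
have BE := upper_constant_ge L1; rewrite -/B in BE.
(* At [L = 3] the estimate used for larger [L] would give [64/25 * 4 = 10.24], while [BE] allows
   only about 9.61. *)
have [L4|L3] := leqP 4 L; last first.
  have K1 p j : cabs2 (vdm p j) <= 1 by rewrite cabs2_cis.
  apply: (le_trans (frobenius_le c K1)); rewrite ler_wpM2r // mulr1.
  apply: le_trans BE.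
  have : (L == 2%N) || (L == 3%N) by lia.
  by case/orP => /eqP ->; lra.
have H := sampled_upper ap (ltW aL) (fun j => (c j)^*%C).
apply: (@le_trans _ _ (pi ^+ 2 / 4 / a * \sum_j cabs2 (c j))).
  have -> : \sum_j cabs2 (c j) = \sum_j cabs2 ((c j)^*%C).
    by apply: eq_bigr => j _; rewrite cabs2_conj.
  (* [sampled_upper] covers all [L + 1] rows; the nonnegative term of row [m] is dropped. *)
  apply: le_trans H; rewrite [leRHS](bigD1_ord m) //=.
  rewrite ler_wpDl ?cabs2_ge0 //; apply: ler_sum => p _.
  rewrite -cabs2_conj rmorph_sum le_eqVlt; apply/orP; left; apply/eqP; congr cabs2.
  by apply: eq_bigr => j _; rewrite rmorphM.
rewrite ler_wpM2r //; apply: le_trans BE.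
have p0 := pi_gt0 R.
have L4R : 4 <= L%:R :> R by rewrite ler_nat.
(* [64/25] is [(16/5)^2 / 4], and [1 / a <= L + 1]. *)
have b1 : pi ^+ 2 / 4 / a <= 64 / 25 * (L%:R + 1).
  rewrite ler_pdivrMr //.
  have h1 : 1 <= (L%:R + 1) * a by rewrite mulrC natr1 -ler_pdivrMr.
  have h2 : pi ^+ 2 <= (16 / 5) ^+ 2 :> R.
    by rewrite ler_sqr ?nnegrE ?divr_ge0 ?(ltW p0) // pi_le_16_5.
  apply: (@le_trans _ _ (64 / 25)).
    rewrite ler_pdivrMr // (le_trans h2) //; lra.
  by rewrite -[leRHS]mulrA ler_peMr // divr_ge0.
apply: (le_trans b1).
(* There is little room: at [L = 4] the final comparison is 12.8 against about 12.9. *)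
have x64 : 1 / (4 * L%:R ^+ 2) <= 1 / 64 :> R.
  rewrite ler_pdivrMr ?mulr_gt0 ?exprn_gt0 //.
  have : 16 <= L%:R ^+ 2 :> R.
    by rewrite (_ : 16 = 4 ^+ 2) ?ler_sqr ?nnegrE //; ring.
  lra.
have := ler_wpM2r (ltW Lp) x64.
rewrite (_ : 13 / 8 * _ * L%:R
   = 13 / 4 * L%:R - 13 / 8 * (1 / (4 * L%:R ^+ 2) * L%:R)); last first.
  by field; rewrite gt_eqF.
by move: (1 / _ * _) => y; lra.
Qed.

Lemma vdm_dual_upper (w : 'I_L -> R[i]) :
  \sum_j cabs2 (\sum_p (vdm p j)^*%C * w p) <= B * \sum_p cabs2 (w p).
Proof. exact: dual_upper vdm_upper w. Qed.

End MatrixBounds.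

Section FrequencyRange.
Context {R : realType}.

(** If [beta < 1 / (L + 1)], then [x = pi * beta] and [y = pi * L * beta] satisfy [x < y] and
    [x + y < pi], so [sin x < sin y] and the quotient exceeds 1. But [L * sin (1 / L) <= 1]. *)
Lemma beta_ge (L : nat) (beta : R) : (2 <= L)%N -> 0 < beta ->
  beta < 1 / L%:R ->
  sin (pi * L%:R * beta) / sin (pi * beta) = L%:R * sin (1 / L%:R) ->
  1 / L.+1%:R <= beta.
Proof.
move=> L_ge2 b0 b1 H; have p0 := pi_gt0 R.
have Lp : 0 < L%:R :> R by rewrite ltr0n; lia.
have L1 : 1 <= L%:R :> R by rewrite ler1n; lia.
rewrite leNgt; apply/negP => bL.
have bL1 : beta * (L%:R + 1) < 1 by rewrite natr1 -ltr_pdivlMr.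
have x0 : 0 < pi * beta by rewrite mulr_gt0.
have xy : pi * beta < pi * L%:R * beta.
  by rewrite -mulrA ltr_pM2l // ltr_pMl // ltr1n.
have xypi : pi * beta + pi * L%:R * beta < pi.
  rewrite (_ : _ + _ = pi * (beta * (L%:R + 1))); last by move: (pi : R) => q; ring.
  by rewrite gtr_pMr.
have s0 : 0 < sin (pi * beta).
  by apply: sin_gt0_pi; rewrite x0 (lt_trans _ xypi) // ltrDl (lt_trans x0).
have := mul_sin_inv_le L1; rewrite -H ler_pdivrMr // mul1r leNgt => /negP; apply.
move: xy xypi x0; move: (pi * beta) (pi * L%:R * beta) => x y xy xypi x0.
rewrite -subr_gt0.
have -> : sin x = sin ((x + y) / 2 - (y - x) / 2) by congr sin; field.
have -> : sin y = sin ((x + y) / 2 + (y - x) / 2) by congr sin; field.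
rewrite sinB sinD.
have c0 : 0 < cos ((x + y) / 2).
  by apply: cos_gt0_pihalf; move: (pi : R) p0 xypi => q p0 xypi; apply/andP; split; lra.
have d0 : 0 < sin ((y - x) / 2).
  by apply: sin_gt0_pi; move: (pi : R) p0 xypi => q p0 xypi; apply/andP; split; lra.
move: ((x + y) / 2) ((y - x) / 2) c0 d0 => p q c0 d0.
rewrite (_ : sin p * cos q + cos p * sin q - (sin p * cos q - cos p * sin q)
  = 2 * (cos p * sin q)); last by ring.
by rewrite mulr_gt0 // mulr_gt0.
Qed.

End FrequencyRange.

(** * Cutting the domain into unit cells *)

Section Unfolding.
Context {R : realType}.
Local Open Scope complex_scope.
Local Notation mu := (@lebesgue_measure R).
Local Notation U := (`[0%R, 1%R[%classic : set R).

Let shift_fun (p : R) : measurableTypeR R -> measurableTypeR R := fun y => y + p.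

Let measurable_shift (p : R) : measurable_fun [set: measurableTypeR R] (shift_fun p).
Proof. by apply: measurable_funD => //; exact: measurable_cst. Qed.

Let shift_preimage (p a b : R) b1 b2 :
  (shift_fun p) @^-1` [set` Interval (BSide b1 a) (BSide b2 b)]
  = [set` Interval (BSide b1 (a - p)) (BSide b2 (b - p))].
Proof.
apply/seteqP; split=> x /=; rewrite !in_itv /= /shift_fun;
  by case: b1; case: b2; rewrite /= ?lerBlDr ?lerBrDr ?ltrBlDr ?ltrBrDr.
Qed.

(** Translation invariance, from the uniqueness of the measure with prescribed values on
    intervals. *)
Lemma lebesgue_measure_shift (p : R) (A : set R) : measurable A ->
  pushforward mu (shift_fun p) A = mu A.
Proof.
move=> mA.
pose phi : {mfun measurableTypeR R >-> measurableTypeR R} :=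
  HB.pack (shift_fun p) (isMeasurableFun.Build _ _ _ _ _ (measurable_shift p)).
apply/esym; apply: (@lebesgue_measure_unique R (pushforward mu phi)) => //= _ [[a b]] _ <-.
rewrite /pushforward /= shift_preimage !lebesgue_measure_itv /= !lte_fin ltrD2r.
by case: ifP => // _; rewrite -!EFinB opprB addrA subrK.
Qed.

Lemma ge0_integral_shift (f : R -> \bar R) (p : R) :
  measurable_fun `[p, p + 1[ f -> (forall x, (0 <= f x)%E) ->
  (\int[mu]_(x in `[p, (p + 1)%R[) f x = \int[mu]_(y in U) f (y + p)%R)%E.
Proof.
move=> mf f0.
have -> : U = (shift_fun p) @^-1` `[p, (p + 1)[.
  by rewrite shift_preimage subrr addrAC subrr add0r.
rewrite -(ge0_integral_pushforward (measurable_shift p)) //=.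
by apply: eq_measure_integral => //= A mA AS; exact/esym/lebesgue_measure_shift.
Qed.

Lemma integral_shift (f : R -> R) (p : R) : measurable_fun `[p, p + 1[ f ->
  (\int[mu]_(x in `[p, (p + 1)%R[) (f x)%:E = \int[mu]_(y in U) (f (y + p)%R)%:E)%E.
Proof.
move=> mf; rewrite integralE [RHS]integralE.
have mf' : measurable_fun `[p, p + 1[ (EFin \o f) by exact/measurable_EFinP.
congr (_ - _)%E.
- by apply: (etrans (ge0_integral_shift (measurable_funepos mf') _)) => //;
    apply: eq_integral => x _; rewrite !funeposE.
- by apply: (etrans (ge0_integral_shift (measurable_funeneg mf') _)) => //;
    apply: eq_integral => x _; rewrite !funenegE.
Qed.

Variables (L : nat) (m : 'I_L.+1).

Local Notation D := (`[0, L.+1%:R[ `\` `]m%:R, (m%:R + 1)[ : set R).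

Let cell (p : 'I_L) : set R := `[(lift m p)%:R, (lift m p)%:R + 1[.

Let mD : measurable D.
Proof. by apply: measurableD; exact: measurable_itv. Qed.

Let mcell p : measurable (cell p). Proof. exact: measurable_itv. Qed.

Let E := \big[setU/set0]_(p <- index_enum 'I_L) cell p.

Let mem_E x : E x <-> exists p, cell p x.
Proof.
rewrite /E; split.
- rewrite -bigcup_seq => -[p _ px]; by exists p.
- by move=> [p px]; rewrite -bigcup_seq; exists p => //=; rewrite mem_index_enum.
Qed.

(** The removed interval is open, so its left end [m] stays in the domain without belonging to a
    kept cell; it is a null set. *)
Let DE : D = E `|` [set m%:R].
Proof.
apply/seteqP; split=> x.
- move=> [/=]; rewrite !in_itv /= => /andP[x0 xN] xm.
  pose k := Num.truncn x.
  have /andP[k1 k2] : k%:R <= x < k.+1%:R by exact: truncn_itv.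
  have kL : (k < L.+1)%N by rewrite -(ltr_nat R); exact: le_lt_trans xN.
  have [km|km] := eqVneq (Ordinal kL) m.
    right; apply/eqP; rewrite eq_le; move: k1 k2; rewrite -km /= => k1 k2.
    rewrite k1 andbT leNgt; apply/negP => kx; apply: xm.
    by rewrite -km /= kx /= natr1.
  left; apply/mem_E; case: (unliftP m (Ordinal kL)) km => [p pE _|->]; last by rewrite eqxx.
  exists p; rewrite /cell -pE /= in_itv /= k1 /=.
  by rewrite natr1.
- move=> [/mem_E[p]|->].
  + rewrite /cell /= !in_itv /= => /andP[x1 x2].
    have pL : (lift m p < L.+1)%N := ltn_ord _.
    split.
      by rewrite (le_trans _ x1) //= (lt_le_trans x2) // natr1 ler_nat.
    move=> /andP[y1 y2].
    have h1 : m%:R < (lift m p)%:R + 1 :> R by exact: lt_trans x2.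
    have h2 : (lift m p)%:R < m%:R + 1 :> R by exact: le_lt_trans y2.
    move: h1 h2; rewrite !natr1 !ltr_nat !ltnS => h1 h2.
    by have := neq_lift m p; rewrite -val_eqE /= eqn_leq h1 h2.
  + split; rewrite /= !in_itv /=; first by rewrite ler0n ltr_nat ltn_ord.
    by rewrite ltxx.
Qed.

Let cell_triv : trivIset [set` index_enum 'I_L] cell.
Proof.
apply/trivIsetP => i j _ _ ij; apply/seteqP; split=> x //.
rewrite /cell /= !in_itv /= => -[/andP[i1 i2] /andP[j1 j2]].
have h1 : (lift m i)%:R < (lift m j)%:R + 1 :> R by exact: le_lt_trans j2.
have h2 : (lift m j)%:R < (lift m i)%:R + 1 :> R by exact: le_lt_trans i2.
move: h1 h2; rewrite !natr1 !ltr_nat !ltnS => h1 h2.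
move: ij => /eqP; apply; apply: (lift_inj (h := m)); apply: val_inj; apply/eqP.
by rewrite eqn_leq h1 h2.
Qed.

Let cell_sub p : cell p `<=` D.
Proof. by move=> x px; rewrite DE; left; apply/mem_E; exists p. Qed.

Lemma integral_unfold (f : R -> R) : measurable_fun D f ->
  (\int[mu]_(x in D) (f x)%:E =
   \sum_(p < L) \int[mu]_(y in U) (f (y + (lift m p)%:R)%R)%:E)%E.
Proof.
move=> mf.
have mE : measurable E by rewrite /E; apply: bigsetU_measurable => p _.
have ED : E `<=` D by rewrite DE; left.
have mfE : measurable_fun E (EFin \o f).
  by apply/measurable_EFinP; exact: measurable_funS mf.
have nE : ~ E m%:R.
  move=> /mem_E[p]; rewrite /cell /= in_itv /= natr1 ltr_nat ler_nat ltnS => /andP[h1 h2].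
  by have := neq_lift m p; rewrite -val_eqE /= eqn_leq h1 h2.
have -> : (\int[mu]_(x in D) (f x)%:E = \int[mu]_(x in E) (f x)%:E)%E.
  rewrite DE integral_setU.
  - by rewrite integral_set1 adde0.
  - exact: mE.
  - exact: measurable_set1.
  - by rewrite -DE; exact/measurable_EFinP.
  - by apply/disj_setPS => x [Ex xm]; apply: nE; rewrite -xm.
rewrite /E integral_bigsetU_EFin //; last exact: index_enum_uniq.
apply: eq_bigr => p _; apply: integral_shift.
by apply: measurable_funS mf => //; exact: cell_sub.
Qed.

Definition piece (w : R -> R[i]) (p : 'I_L) (y : R) : R[i] := w (y + (lift m p)%:R).

Lemma measurable_piece (g : R -> R) (p : 'I_L) : measurable_fun D g ->
  measurable_fun U (fun y => g (y + (lift m p)%:R)).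
Proof.
move=> mg; apply: (measurable_comp mD _ mg).
  move=> _ [y /= + <-]; rewrite in_itv /= => /andP[y0 y1].
  by apply: (cell_sub (p := p)); rewrite /cell /= in_itv /= lerDr y0 addrC ltrD2l.
by apply: measurable_funD => //; exact: measurable_cst.
Qed.

Lemma cmeasurable_piece w p : cmeasurable D w -> cmeasurable U (piece w p).
Proof.
by move=> [w1 w2]; split; [exact: (measurable_piece p w1)|exact: (measurable_piece p w2)].
Qed.

Lemma L2norm2_unfold w : cmeasurable D w ->
  L2norm2 D w = (\sum_(p < L) L2norm2 U (piece w p))%E.
Proof. by move=> mw; exact: (integral_unfold (measurable_cabs2 mw)). Qed.

Lemma L2_piece w p : L2 D w -> L2 U (piece w p).
Proof.
move=> lw; have mw := L2_cmeasurable lw; have [m1 m2] := cmeasurable_piece p mw.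
split=> //; case: lw => _ _; rewrite L2norm2_unfold //; apply: le_lt_trans.
rewrite (bigD1 p) //= leeDl // sume_ge0 // => q _; exact: L2norm2_ge0.
Qed.

Lemma Rintegral_unfold (f : R -> R) : measurable_fun D f ->
  (forall p : 'I_L, mu.-integrable U (fun y => (f (y + (lift m p)%:R))%:E)) ->
  (\int[mu]_(x in D) f x = \sum_(p < L) \int[mu]_(y in U) f (y + (lift m p)%:R))%R.
Proof.
move=> mf intf; rewrite /Rintegral integral_unfold //.
have fK (p : 'I_L) : (\int[mu]_(y in U) (f (y + (lift m p)%:R))%:E =
    (fine (\int[mu]_(y in U) (f (y + (lift m p)%:R))%:E))%:E)%E.
  by rewrite fineK // (integrable_fin_num _ (intf p)).
by under eq_bigr do rewrite fK; rewrite sumEFin.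
Qed.

Lemma L2dot_unfold w v : L2 D w -> L2 D v ->
  L2dot D w v = \sum_(p < L) L2dot U (piece w p) (piece v p).
Proof.
move=> lw lv.
have [m1 m2] := cmeasurableM (L2_cmeasurable lw) (cmeasurable_conj (L2_cmeasurable lv)).
have ip p := integrable_conjM (measurable_itv _) (L2_piece p lw) (L2_piece p lv).
apply/eqP; rewrite eq_complex !raddf_sum /=; apply/andP; split; apply/eqP.
- by apply: (Rintegral_unfold m1) => p; have [] := ip p.
- by apply: (Rintegral_unfold m2) => p; have [] := ip p.
Qed.

End Unfolding.

(** * The two Riesz inequalities for the exponentials *)

Section ExponentialRiesz.
Context {R : realType}.
Local Open Scope complex_scope.
Local Notation mu := (@lebesgue_measure R).
Local Notation U := (`[0%R, 1%R[%classic : set R).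

Let mU : measurable U. Proof. exact: measurable_itv. Qed.

Lemma L2_unimodular (D : set R) (u f : R -> R[i]) : measurable D -> cmeasurable D u ->
  (forall x, cabs2 (u x) = 1) -> L2 D f -> L2 D (fun x => u x * f x).
Proof.
move=> mD mu_ u1 lf; have [m1 m2] := cmeasurableM mu_ (L2_cmeasurable lf).
split=> //; case: lf => _ _; apply: le_lt_trans.
by rewrite /L2norm2; under eq_integral do rewrite cabs2M u1 mul1r.
Qed.

Lemma sum_L2norm2 (n : nat) (g : 'I_n -> R -> R[i]) :
  (forall i, cmeasurable U (g i)) ->
  (\sum_(i < n) L2norm2 U (g i) = \int[mu]_(y in U) (\sum_(i < n) cabs2 (g i y))%:E)%E.
Proof.
move=> mg; rewrite /L2norm2 -ge0_integral_sum //.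
- by apply: eq_integral => y _; rewrite sumEFin.
- by move=> i; exact: measurable_cabs2_EFin.
- by move=> i y _; rewrite lee_fin cabs2_ge0.
Qed.

(** Carries the matrix inequalities, which hold at each [y] for the vectors of values, over to
    squared norms. *)
Lemma sum_L2norm2_le (n : nat) (g h : 'I_n -> R -> R[i]) (A B : R) :
  0 <= A -> 0 <= B ->
  (forall i, cmeasurable U (g i)) -> (forall i, cmeasurable U (h i)) ->
  (forall y, A * \sum_i cabs2 (g i y) <= B * \sum_i cabs2 (h i y)) ->
  (A%:E * \sum_(i < n) L2norm2 U (g i) <= B%:E * \sum_(i < n) L2norm2 U (h i))%E.
Proof.
move=> A0 B0 mg mh H; rewrite !sum_L2norm2 //.
have ms (f : 'I_n -> R -> R[i]) : (forall i, cmeasurable U (f i)) ->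
    measurable_fun U (fun y => (\sum_i cabs2 (f i y))%:E).
  move=> mf; apply/measurable_EFinP; apply: measurable_sum => i.
  exact: measurable_cabs2.
have s0 (f : 'I_n -> R -> R[i]) y : 0 <= \sum_i cabs2 (f i y).
  by apply: sumr_ge0 => i _; exact: cabs2_ge0.
rewrite -!ge0_integralZl //; try exact: ms; try by move=> y _; rewrite lee_fin s0.
apply: ge0_le_integral => //.
- by move=> y _; rewrite -EFinM lee_fin mulr_ge0.
- by apply: measurable_funeM; exact: ms.
- by apply: measurable_funeM; exact: ms.
- by move=> y _; rewrite -!EFinM lee_fin.
Qed.

Variables (L : nat) (m : 'I_L.+1) (a : R).
Hypotheses (L_ge2 : (2 <= L)%N).
Hypotheses (a0 : 1 / L.+1%:R <= a) (a1 : a <= 1 / L%:R - 1 / (2 * L%:R ^+ 2)).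

Local Notation D := (`[0, L.+1%:R[ `\` `]m%:R, (m%:R + 1)[ : set R).

Let mD : measurable D.
Proof. by apply: measurableD; exact: measurable_itv. Qed.

Let v (k : 'I_L * int) : R -> R[i] := cexp2pi (k.2%:~R + k.1%:R * a).

Let A : R := pi / (32 * L%:R).
Let B : R := (1 + L%:R * sin (1 / L%:R)) * (L%:R + 1 / sin (pi / (2 * L%:R))).

Let A0 : 0 < A.
Proof. by rewrite /A divr_gt0 ?pi_gt0 // mulr_gt0 // ltr0n; lia. Qed.

Let B0 : 0 < B.
Proof.
have L1 : 1 <= L%:R :> R by rewrite ler1n; lia.
apply: lt_le_trans (upper_constant_ge L1).
have l0 : 0 < L%:R :> R by exact: lt_le_trans ltr01 L1.
apply: mulr_gt0 => //; apply: mulr_gt0; first by lra.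
rewrite subr_gt0 ltr_pdivrMr ?mulr_gt0 ?exprn_gt0 //.
by have := exprn_ege1 2 L1; lra.
Qed.

(** An integer translation is invisible to the integer frequency [k.2]; only [k.1 * a] contributes a
    factor, which is a matrix entry. *)
Let piece_v k (p : 'I_L) y : piece m (v k) p y =
  vdm a m p k.1 * (cexp2pi (k.1%:R * a) y * cexp2pi k.2%:~R y).
Proof.
rewrite /piece /v /vdm !cexp2piE -!cisD.
have -> : 2 * pi * (k.2%:~R + k.1%:R * a) * (y + (lift m p)%:R)
  = (2 * (pi * a) * (lift m p)%:R * k.1%:R + (2 * pi * (k.1%:R * a) * y
      + 2 * pi * k.2%:~R * y)) + 2 * pi * (k.2 * (lift m p)%:Z)%:~R.
  by rewrite rmorphM /= -pmulrn; ring.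
by rewrite [LHS]cisD cis_2pi_int mulr1.
Qed.

Let L2_v k : L2 D (v k).
Proof.
apply: (@L2_bounded _ _ mD _ 1).
- exact: cmeasurable_cis.
- apply: (@le_lt_trans _ _ (mu `[0, L.+1%:R[)).
    apply: le_measure; rewrite ?inE; [exact: mD|exact: measurable_itv|exact: subDsetl].
  by rewrite lebesgue_measure_itv /=; case: ifP => _; rewrite ?ltry // -EFinB ltry.
- by move=> x _; rewrite /v cexp2piE cabs2_cis.
Qed.

(** The pieces of the sum are the matrix applied to the vector of the [g j], where [g j] collects
    the terms with first index [j]. Its unimodular prefactor does not affect the norm, so
    orthonormality of the integer exponentials yields the sum of the [cabs2 (c k)]. *)
Lemma exponentials_riesz_sequence (J : {fset 'I_L * int}) (c : 'I_L * int -> R[i]) :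
  let S := L2norm2 D (fun x => \sum_(j <- J) c j * v j x) in
  let s := \sum_(j <- J) cabs2 (c j) in
  ((A * s)%:E <= S)%E /\ (S <= (B * s)%:E)%E.
Proof.
set F := fun x => \sum_(j <- J) c j * v j x.
have lF : L2 D F by apply: L2_sum => // k _; apply: L2Z.
pose f (j : 'I_L) y := \sum_(k <- [seq k <- J | k.1 == j]) c k * cexp2pi k.2%:~R y.
pose g (j : 'I_L) y := cexp2pi (j%:R * a) y * f j y.
have mg j : cmeasurable U (g j).
  apply: cmeasurableM; first exact: cmeasurable_cis.
  apply: cmeasurable_sum => k _; apply: cmeasurableM; first exact: cmeasurable_cst.
  exact: cmeasurable_cis.
have FE p y : piece m F p y = \sum_j vdm a m p j * g j y.
  rewrite /piece /F (partition_big (fun k => k.1) predT) //=.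
  apply: eq_bigr => j _; rewrite /g /f big_filter !mulr_sumr.
  apply: eq_bigr => k /eqP <-; rewrite -/(piece m (v k) p y) piece_v.
  by rewrite mulrCA; congr (_ * _); rewrite mulrCA.
have nf j : L2norm2 U (g j) = (\sum_(k <- J | k.1 == j) cabs2 (c k))%:E.
  transitivity (L2norm2 U (f j)).
    by apply: eq_integral => y _; rewrite /g cabs2M cexp2piE cabs2_cis mul1r.
  rewrite /f (L2norm2_orthonormal mU) ?filter_uniq ?fset_uniq // ?big_filter //.
    by move=> k _; exact: L2_cexp2pi.
  move=> k k'; rewrite !mem_filter => /andP[/eqP k1 _] /andP[/eqP k1' _].
  rewrite cexp2pi_orthonormal; congr (_%:R).
  by case: k k' k1 k1' => [k1 k2] [k1' k2'] /= -> ->; rewrite xpair_eqE eqxx.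
have sg : (\sum_(j < L) L2norm2 U (g j) = (\sum_(k <- J) cabs2 (c k))%:E)%E.
  under eq_bigr do rewrite nf.
  by rewrite sumEFin [in RHS](partition_big (fun k => k.1) predT).
move=> S s; rewrite /S L2norm2_unfold //; last exact: L2_cmeasurable.
rewrite !EFinM /s -sg; split.
- rewrite -[leRHS]mul1e; apply: sum_L2norm2_le => //; first exact: ltW.
  + by move=> p; apply: cmeasurable_piece => //; exact: L2_cmeasurable.
  + move=> y; rewrite [leRHS]mul1r; under [leRHS]eq_bigr do rewrite FE.
    exact: (vdm_lower L_ge2 a0 a1).
- rewrite -[leLHS]mul1e; apply: sum_L2norm2_le => //; first exact: ltW.
  + by move=> p; apply: cmeasurable_piece => //; exact: L2_cmeasurable.
  + move=> y; rewrite [leLHS]mul1r; under [leLHS]eq_bigr do rewrite FE.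
    exact: (vdm_upper L_ge2 a0 a1).
Qed.

(** For fixed [j] the products of [w] with the [v (j, n)] are the Fourier coefficients of [h j],
    which is a unimodular function times the adjoint matrix applied to the pieces. [parseval] sums
    over [n], and the dual bounds apply at each [y]. *)
Lemma exponentials_frame (w : R -> R[i]) : L2 D w ->
  let S := (\esum_(j in [set: 'I_L * int]) (cabs2 (L2dot D w (v j)))%:E)%E in
  (A%:E * L2norm2 D w <= S)%E /\ (S <= B%:E * L2norm2 D w)%E.
Proof.
move=> lw S; have lp p := L2_piece p lw.
have mp p := L2_cmeasurable (lp p).
pose u (j : 'I_L) (y : R) : R[i] := (cexp2pi (j%:R * a) y)^*%C.
have mu_ j : cmeasurable U (u j) by apply: cmeasurable_conj; exact: cmeasurable_cis.
have u1 j y : cabs2 (u j y) = 1 by rewrite /u cabs2_conj cexp2piE cabs2_cis.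
pose H (j p : 'I_L) y := (vdm a m p j)^*%C * (u j y * piece m w p y).
have lH j p : L2 U (H j p) by apply: L2Z => //; apply: L2_unimodular.
pose h (j : 'I_L) y := \sum_(p <- index_enum 'I_L) H j p y.
have lh j : L2 U (h j) by apply: L2_sum => // p _; exact: lH.
have cM (z z' : R[i]) : (z * z')^*%C = z^*%C * z'^*%C by exact: rmorphM.
have dE k : L2dot D w (v k) = L2dot U (h k.1) (cexp2pi k.2%:~R).
  rewrite L2dot_unfold // /h L2dot_sum //; last exact: L2_cexp2pi.
  apply: eq_bigr => p _; apply: L2dot_mulE => y _; rewrite piece_v.
  by rewrite !cM /H mulrCA -[RHS]mulrA; congr (_ * _); rewrite mulrCA mulrA.
have SE : S = (\sum_(j < L) L2norm2 U (h j))%E.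
  rewrite /S; under eq_esum do rewrite dE.
  have -> : [set: 'I_L * int] = [set: 'I_L] `*`` (fun=> [set: int]).
    by apply/seteqP; split.
  rewrite -(esum_esum
    (a := fun j n => (cabs2 (L2dot U (h j) (cexp2pi n%:~R)))%:E)); last first.
    by move=> j n _ _; rewrite lee_fin cabs2_ge0.
  under eq_esum do rewrite parseval //.
  rewrite (_ : [set: 'I_L] = [set` index_enum 'I_L]); last first.
    by apply/seteqP; split=> // x _ /=; rewrite mem_index_enum.
  rewrite esum_fset; last 2 first.
  - exact: finite_seq.
  - by move=> j _; exact: L2norm2_ge0.
  by rewrite -fsbig_seq // index_enum_uniq.
have hE j y : cabs2 (h j y) = cabs2 (\sum_p (vdm a m p j)^*%C * piece m w p y).
  rewrite /h /H; under eq_bigr do rewrite mulrCA.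
  by rewrite -mulr_sumr cabs2M u1 mul1r.
rewrite SE L2norm2_unfold //; last exact: L2_cmeasurable.
split.
- rewrite -[leRHS]mul1e; apply: sum_L2norm2_le => //; first exact: ltW.
  + by move=> j; exact: L2_cmeasurable.
  + move=> y; rewrite [leRHS]mul1r; under [leRHS]eq_bigr do rewrite hE.
    exact: (vdm_dual_lower L_ge2 a0 a1).
- rewrite -[leLHS]mul1e; apply: sum_L2norm2_le => //; first exact: ltW.
  + by move=> j; exact: L2_cmeasurable.
  + move=> y; rewrite [leLHS]mul1r; under [leLHS]eq_bigr do rewrite hE.
    exact: (vdm_dual_upper L_ge2 a0 a1).
Qed.

Lemma exponentials_riesz_basis : riesz_basis D v A B.
Proof.
split=> //.
- exact: exponentials_riesz_sequence.
- exact: exponentials_frame.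
Qed.

End ExponentialRiesz.

Theorem theorem1p3 (R : realType) (N m : nat) (beta delta : R)
  (hN : (2 < N)%N) (hm0 : (0 < m)%N) (hm : (m < N - 1)%N)
  (hbeta0 : 0 < beta) (hbeta1 : beta < 1 / (N%:R - 1))
  (hbeta : sin (pi * (N%:R - 1) * beta) / sin (pi * beta)
           = (N%:R - 1) * sin (1 / (N%:R - 1)))
  (hdelta0 : 1 / (2 * (N%:R - 1) ^+ 2) < delta)
  (hdelta1 : delta < 1 / (N%:R - 1) - beta) :
  exists A B : R,
    [/\ riesz_basis (`[0, N%:R[ `\` `]m%:R, (m%:R + 1)[)
          (exp_system (N := N) delta) A B,
        (1 - (N%:R - 1) * sin (1 / (N%:R - 1)))
          * (N%:R - 1 - 1 / sin (pi / (2 * (N%:R - 1)))) <= A &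
        B <= (1 + (N%:R - 1) * sin (1 / (N%:R - 1)))
          * (N%:R - 1 + 1 / sin (pi / (2 * (N%:R - 1))))].
Proof.
case: N hN hm hbeta1 hbeta hdelta0 hdelta1 => // L hN hm.
have NL : L.+1%:R - 1 = L%:R :> R by rewrite -natr1 addrK.
rewrite !NL => hbeta1 hbeta hdelta0 hdelta1.
have L_ge2 : (2 <= L)%N by lia.
have L1 : 1 <= L%:R :> R by rewrite ler1n; lia.
have b := beta_ge L_ge2 hbeta0 hbeta1 hbeta.
pose a := 1 / L%:R - delta.
have a0 : 1 / L.+1%:R <= a by rewrite (le_trans b) // /a lerBrDr -lerBrDl ltW.
have a1 : a <= 1 / L%:R - 1 / (2 * L%:R ^+ 2) by rewrite lerD2l lerN2 ltW.
have mL1 : (m < L.+1)%N by lia.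
(* The upper constant is the claimed bound itself; only the lower one calls for a comparison. *)
exists (pi / (32 * L%:R)),
  ((1 + L%:R * sin (1 / L%:R)) * (L%:R + 1 / sin (pi / (2 * L%:R)))).
split; last 2 first.
- exact: lower_constant_le.
- by [].
have := @exponentials_riesz_basis R L (Ordinal mL1) a L_ge2 a0 a1.
congr riesz_basis; apply/funext => k; rewrite /exp_system NL; congr cexp2pi.
by rewrite /a; ring.
Qed.
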